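(* Let $(T,M)$ be a complete local ring. Then $T$ is the completion of a local domain $A$ such that $|A| < |T|$ if and only if the following three conditions hold: (i) no integer of $T$ is a zerodivisor; (ii) $M \notin \operatorname{Ass}(T)$; (iii) $|T/M| < |T|$.
   Context: All rings are commutative with $1$. ''Local'' means Noetherian with exactly one maximal ideal; $(T,M)$ local means $M$ is the maximal ideal of $T$; ''complete'' means complete with respect to the $M$-adic topology. For a local ring $(A,\mathfrak m)$, ''$T$ is the completion of $A$'' means that the $\mathfrak m$-adic completion $\widehat A$ is isomorphic to $T$. $\operatorname{Ass}(T)$ is the set of associated primes of the $T$-module $T$. An integer of $T$ is an element of the prime subring $\mathbb Z\cdot 1_T$; $0$ is not counted as a zerodivisor, so condition (i) says that no nonzero element of $\mathbb Z\cdot 1_T$ is a zerodivisor in $T$. *)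

(* Defs.v *)
From HB Require Import structures.
From mathcomp Require Import all_boot all_algebra.
From mathcomp Require Import ring_quotient.
From mathcomp Require Import boolp classical_sets functions cardinality.

Set Implicit Arguments.
Unset Strict Implicit.
Unset Printing Implicit Defensive.

Import GRing.Theory.
Local Open Scope ring_scope.
Local Open Scope quotient_scope.
Local Open Scope classical_set_scope.
Local Open Scope card_scope.

Definition card_lt (X Y : Type) : Prop :=
  ([set: X] #<= [set: Y]) /\ ([set: X] #!= [set: Y]).

Section Ideals.
Variable R : comNzRingType.

(* Unlike [idealr], this allows the unit ideal. *)
Definition ideal (J : {pred R}) : Prop :=
  [/\ 0 \in J, {in J &, forall u v, u + v \in J}
    & forall a, {in J, forall u, a * u \in J}].

Definition finitely_generated (J : {pred R}) : Prop :=
  exists s : seq R, forall x, x \in J <->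
    exists c : 'I_(size s) -> R, x = \sum_(i < size s) c i * s`_i.

Definition noetherian : Prop :=
  forall J : {pred R}, ideal J -> finitely_generated J.

Definition maximal_ideal (M : idealr R) : Prop :=
  forall J : idealr R, {subset M <= J} -> J =i M.

Definition local_ring (M : idealr R) : Prop :=
  [/\ noetherian, maximal_ideal M
    & forall N : idealr R, maximal_ideal N -> N =i M].

Definition zerodivisor (t : R) : Prop := exists2 y, y != 0 & t * y = 0.

Definition annihilator (x : R) : {pred R} := [pred a | a * x == 0].

Definition Ass : set {pred R} :=
  [set P | [/\ idealr_closed P, prime_idealr_closed P
             & exists x, P =i annihilator x]].

(* R-linear combinations of n-fold products of elements of I; for n = 0 this
   is the unit ideal. *)
Definition ideal_pow (I : idealr R) (n : nat) : {pred R} := fun x =>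
  `[< exists k (c : 'I_k -> R) (a : 'I_k -> 'I_n -> R),
        (forall i j, a i j \in I) /\
        x = \sum_(i < k) c i * \prod_(j < n) a i j >].

End Ideals.

Arguments Ass R : clear implicits.

Section IdealPowTheory.
Variables (R : comNzRingType) (I : idealr R).

Lemma ideal_powP n x : reflect
  (exists k (c : 'I_k -> R) (a : 'I_k -> 'I_n -> R),
     (forall i j, a i j \in I) /\
     x = \sum_(i < k) c i * \prod_(j < n) a i j)
  (x \in ideal_pow I n).
Proof. exact: asboolP. Qed.

Lemma ideal_pow_sub n : {subset ideal_pow I n.+1 <= I}.
Proof.
move=> x /ideal_powP[k [c [a [aI ->]]]]; apply: rpred_sum => i _.
by rewrite big_ord_recl mulrCA mulrC idealMr.
Qed.

Lemma ideal_pow_decr n : {subset ideal_pow I n.+1 <= ideal_pow I n}.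
Proof.
move=> x /ideal_powP[k [c [a [aI ->]]]]; apply/ideal_powP.
exists k, (fun i => c i * a i ord0), (fun i j => a i (lift ord0 j)).
by split=> //; apply: eq_bigr => i _; rewrite big_ord_recl mulrA.
Qed.

Lemma ideal_pow_idealr_closed n : idealr_closed (ideal_pow I n.+1).
Proof.
split; first by apply/ideal_powP; exists 0%N, (fun=> 0), (fun _ _ => 0); split;
  [case | rewrite big_ord0].
  by apply/negP => /ideal_pow_sub; rewrite idealr1.
move=> r u v /ideal_powP[k [c [a [aI ->]]]] /ideal_powP[l [d [b [bI ->]]]].
apply/ideal_powP; exists (k + l)%N,
  (fun i => match fintype.split i with inl i => r * c i | inr j => d j end),
  (fun i => match fintype.split i with inl i => a i | inr j => b j end).
split; first by move=> i; case: (fintype.split i).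
rewrite big_split_ord /= mulr_sumr; congr (_ + _); apply: eq_bigr => i _.
  by rewrite mulrA (unsplitK (inl i)).
by rewrite (unsplitK (inr i)).
Qed.

HB.instance Definition _ n :=
  isIdealr.Build R (ideal_pow I n.+1) (ideal_pow_idealr_closed n).

End IdealPowTheory.

(* The product of the R n, as a copy of [forall n, R n] carrying the pointwise
   ring structure. *)
Definition prod_ring (R : nat -> comNzRingType) : Type := forall n, R n.

Section ProdRing.
Variable R : nat -> comNzRingType.
Implicit Types f g h : prod_ring R.

HB.instance Definition _ := Choice.copy (prod_ring R) (forall n, R n).

Let zero : prod_ring R := fun=> 0.
Let one : prod_ring R := fun=> 1.
Let opp f : prod_ring R := fun n => - f n.
Let add f g : prod_ring R := fun n => f n + g n.
Let mul f g : prod_ring R := fun n => f n * g n.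

Local Ltac pointwise lem :=
  repeat move=> ?; apply: functional_extensionality_dep => n; exact: lem.

Let addA : associative add. Proof. pointwise addrA. Qed.
Let addC : commutative add. Proof. pointwise addrC. Qed.
Let add0 : left_id zero add. Proof. pointwise add0r. Qed.
Let addN : left_inverse zero opp add. Proof. pointwise addNr. Qed.
HB.instance Definition _ :=
  GRing.isZmodule.Build (prod_ring R) addA addC add0 addN.

Let mulA : associative mul. Proof. pointwise mulrA. Qed.
Let mulC : commutative mul. Proof. pointwise mulrC. Qed.
Let mul1 : left_id one mul. Proof. pointwise mul1r. Qed.
Let mulD : left_distributive mul add. Proof. pointwise mulrDl. Qed.
Let one_neq0 : one != zero.
Proof.
apply/eqP => /(congr1 (fun f : prod_ring R => f 0%N)) /eqP.
by rewrite (negPf (oner_neq0 _)).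
Qed.
HB.instance Definition _ := GRing.Zmodule_isComNzRing.Build (prod_ring R)
  mulA mulC mul1 mulD one_neq0.

End ProdRing.

Section AdicCompletion.
Variables (R : comNzRingType) (I : idealr R).

(* R/I^(n+1); the index is shifted because R/I^0 is the zero ring, which plays
   no role in the limit and is not a [comNzRingType]. *)
Definition adic_quot (n : nat) : comNzRingType :=
  {ideal_quot (ideal_pow I n.+1)}.

Definition adic_pi (n : nat) (x : R) : adic_quot n := \pi_(adic_quot n) x.

(* The reduction R/I^(n+2) -> R/I^(n+1); see [adic_transE]. *)
Definition adic_trans (n : nat) (x : adic_quot n.+1) : adic_quot n :=
  adic_pi n (repr x).

Lemma adic_pi_eqP n x y :
  reflect (adic_pi n x = adic_pi n y) (x - y \in ideal_pow I n.+1).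
Proof. by rewrite Quotient.idealrBE; apply: eqP. Qed.

Lemma adic_piK n (x : adic_quot n) : adic_pi n (repr x) = x.
Proof. exact: reprK. Qed.

Lemma adic_transE n x : adic_trans (adic_pi n.+1 x) = adic_pi n x.
Proof.
by apply/adic_pi_eqP/ideal_pow_decr/adic_pi_eqP; rewrite adic_piK.
Qed.

Lemma adic_pi_is_zmod_morphism n : zmod_morphism (adic_pi n).
Proof. exact: (@rmorphB _ _ \pi_(adic_quot n)). Qed.

Lemma adic_pi_is_monoid_morphism n : monoid_morphism (adic_pi n).
Proof.
by split; [exact: (rmorph1 \pi_(adic_quot n)) | exact: (rmorphM \pi_(adic_quot n))].
Qed.

HB.instance Definition _ n := GRing.isZmodMorphism.Build R (adic_quot n)
  (adic_pi n) (adic_pi_is_zmod_morphism n).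
HB.instance Definition _ n := GRing.isMonoidMorphism.Build R (adic_quot n)
  (adic_pi n) (adic_pi_is_monoid_morphism n).

Definition adic_coherent : {pred prod_ring adic_quot} :=
  fun f => `[< forall n, adic_trans (f n.+1) = f n >].

Lemma adic_coherentP (f : prod_ring adic_quot) :
  reflect (forall n, adic_trans (f n.+1) = f n) (f \in adic_coherent).
Proof. exact: asboolP. Qed.

Lemma adic_coherent_subring : subring_closed adic_coherent.
Proof.
split.
- apply/adic_coherentP => n.
  change (adic_trans (1 : adic_quot n.+1) = 1).
  by rewrite -(rmorph1 (adic_pi n.+1)) adic_transE rmorph1.
- move=> f g /adic_coherentP cf /adic_coherentP cg; apply/adic_coherentP => n.
  rewrite -[(f - g) n]/(f n - g n) -[(f - g) n.+1]/(f n.+1 - g n.+1).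
  rewrite -(cf n) -(cg n) -[f n.+1]adic_piK -[g n.+1]adic_piK.
  by rewrite -rmorphB !adic_transE rmorphB.
- move=> f g /adic_coherentP cf /adic_coherentP cg; apply/adic_coherentP => n.
  rewrite -[(f * g) n]/(f n * g n) -[(f * g) n.+1]/(f n.+1 * g n.+1).
  rewrite -(cf n) -(cg n) -[f n.+1]adic_piK -[g n.+1]adic_piK.
  by rewrite -rmorphM !adic_transE rmorphM.
Qed.

HB.instance Definition _ := GRing.isSubringClosed.Build
  (prod_ring adic_quot) adic_coherent adic_coherent_subring.

(* The inverse limit of the R/I^n. *)
Record adic_completion : Type := AdicCompletion {
  adic_val : prod_ring adic_quot;
  adic_valP : adic_val \in adic_coherent }.

HB.instance Definition _ := [isSub for adic_val].
HB.instance Definition _ := [Choice of adic_completion by <:].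
HB.instance Definition _ :=
  [SubChoice_isSubComNzRing of adic_completion by <:].

Lemma to_completion_subproof (x : R) :
  ((fun n => adic_pi n x) : prod_ring adic_quot) \in adic_coherent.
Proof. by apply/adic_coherentP => n; exact: adic_transE. Qed.

Definition to_completion (x : R) : adic_completion :=
  AdicCompletion (to_completion_subproof x).

Definition adic_complete : Prop := bijective to_completion.

End AdicCompletion.

Definition ring_isomorphic (R S : nzRingType) : Prop :=
  exists f : {rmorphism R -> S}, bijective f.

Definition is_completion_of (T A : comNzRingType) (m : idealr A) : Prop :=
  ring_isomorphic (adic_completion m) T.

(* Main.v *)
Require Import Defs.
From HB Require Import structures.
From mathcomp Require Import all_boot all_algebra.
From mathcomp Require Import ring_quotient.
From mathcomp Require Import boolp classical_sets functions cardinality.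

Set Implicit Arguments.
Unset Strict Implicit.
Unset Printing Implicit Defensive.

Import GRing.Theory.
Local Open Scope ring_scope.
Local Open Scope quotient_scope.
Local Open Scope classical_set_scope.

(** Necessity.  Let [T] be the completion of a Noetherian local domain [A] with
maximal ideal [m].  A nonzero [a] in [A] stays a nonzerodivisor in [T]: this
follows from [(a) ∩ m^n ⊆ a m^k] for large [n] ([principal_cap_power]), since
then [a t = 0] forces every approximation of [t] into arbitrarily high powers
of [m].  Applied to the integers this is (i).  Applied to a nonzero element
of [m] it is (ii), for such an element would kill a [t] with [M = ann t]; and
[m] is nonzero, as otherwise [A] would be its own completion and have the
cardinality of [T].  Finally [A] maps onto [T/M], so [|T/M| <= |A| < |T|].

Sufficiency.  Let [k = T/M] and [K = k + nat]; call a set small when it embeds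
into [K].  As [K * K] embeds into [K] ([embeds_square]), small unions of small
sets are small.  The domain [A] is built inside [T], as a small subring whose
nonzero elements are regular in [T] (a good subring), and such that
- every element of [T] is congruent modulo [M] to an element of [A], and [A]
  contains generators of [M] modulo [M^2];
- a linear equation with coefficients in [A] that has a solution in [T] has
  one in [A], that is [I T ∩ A = I] for every finitely generated ideal [I].
By Nakayama's lemma these properties give [(M ∩ A) T = M]; hence [A] is
Noetherian and local, its maximal ideal [M ∩ A] has powers [M^n ∩ A], and [A]
is dense in [T], so that its completion is [T] ([sd_local], [sd_completion]).

Good subrings are enlarged by adjoining generic elements.  Since [M] is not
associated, prime avoidance yields a regular [z] in [M]; sums of power series
in [z] with coefficients in representatives of [k] then give a family of points
of [M^2], indexed by the sequences in [k], whose pairwise differences are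
regular ([regular_differences]).  Zero divisors are covered by finitely many
prime annihilators, modulo each of which a nonzero polynomial has finitely many
roots.  Hence over a good [B] each nonzero polynomial takes a zero divisor as
value at finitely many points of the form [t + a w], for [a] regular and [w] in
the family, and some [w] avoids them all, because the set of sequences in [k] is not small:
[T] embeds into it and [|k| < |T|].  For this [w], the ring [B[t + a w]] is
good.  Taking [a = 1] moves any [t] into a good subring at the cost of a
correction in [M^2]; taking for [a] one of the coefficients of a linear equation
makes the unknowns generic one after the other ([good_lin]).  Zorn's lemma
performs a small set of such steps at once ([good_tasks]), and countably many
rounds close the ring up ([good_closure]). *)

(** * Comparison and squares of cardinals *)

Definition embeds (X Y : Type) : Prop := exists f : X -> Y, injective f.

Lemma card_le_embeds (X Y : Type) :
  ([set: X] #<= [set: Y])%card <-> embeds X Y.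
Proof.
split.
  move=> /card_leP[f]; exists (fun x => val (f (SigSub (mem_set (I : [set: X] x))))).
  move=> x y /val_inj /inj H.
  by have := congr1 val (H (mem_set I) (mem_set I)).
move=> [f fi]; have [g] : $|{injfun [set: X] >-> [set: Y]}|.
  by apply/injfunPex; exists f => // x y _ _; apply: fi.
exact: inj_card_le g.
Qed.

Lemma embeds_trans (X Y Z : Type) : embeds X Y -> embeds Y Z -> embeds X Z.
Proof. by move=> [f fi] [g gi]; exists (g \o f); apply: inj_comp. Qed.

(** Any two cardinals are comparable: a maximal partial matching between [A] and
[B] cannot leave elements unmatched on both sides. *)
Lemma set_comparable (X : Type) (A B : set X) :
  (exists f : X -> X, [/\ forall x, A x -> B (f x)
                        & forall x y, A x -> A y -> f x = f y -> x = y]) \/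
  (exists f : X -> X, [/\ forall x, B x -> A (f x)
                        & forall x y, B x -> B y -> f x = f y -> x = y]).
Proof.
pose P (G : set (X * X)) := [/\ forall p, G p -> A p.1 /\ B p.2,
  forall x y y', G (x, y) -> G (x, y') -> y = y'
  & forall x x' y, G (x, y) -> G (x', y) -> x = x'].
have [|G [[GAB Gf Gi] Gmax]] := @Zorn_bigcup _ P.
  move=> F FP Ftot.
  have big p q : (\bigcup_(G in F) G) p -> (\bigcup_(G in F) G) q ->
      exists2 G, P G & G p /\ G q.
    move=> [G FG Gp] [H FH Hq]; case: (Ftot _ _ FG FH) => sub.
      by exists H; [exact: FP | split=> //; apply: sub].
    by exists G; [exact: FP | split=> //; apply: sub].
  split.
  - by move=> p Fp; have [G [GAB _ _] [/GAB]] := big _ _ Fp Fp.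
  - by move=> x y y' h h'; have [G [_ Gf _] [g g']] := big _ _ h h'; apply: Gf g g'.
  - by move=> x x' y h h'; have [G [_ _ Gi] [g g']] := big _ _ h h'; apply: Gi g g'.
have [Afull|] := pselect (forall x, A x -> exists y, G (x, y)).
  left; have /choice[f fP] : forall x, exists y, A x -> G (x, y).
    move=> x; by case: (pselect (A x)) => [/Afull[y Gy]|nA]; [exists y | exists x].
  exists f; split=> [x /fP /GAB[] //|x y /fP Gx /fP Gy e].
  by rewrite e in Gx; apply: Gi Gx Gy.
move=> /existsNP[a /not_implyP[Aa nGa]].
have [Bfull|] := pselect (forall y, B y -> exists x, G (x, y)).
  right; have /choice[f fP] : forall y, exists x, B y -> G (x, y).
    move=> x; by case: (pselect (B x)) => [/Bfull[y Gy]|nA]; [exists y | exists x].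
  exists f; split=> [x /fP /GAB[] //|x y /fP Gx /fP Gy e].
  by rewrite e in Gx; apply: Gf Gx Gy.
move=> /existsNP[b /not_implyP[Bb nGb]].
exfalso; apply: (Gmax (G `|` [set (a, b)])).
  split; first by move=> p; left.
  by move=> /(_ (a, b)) h; apply: nGa; exists b; apply: h; right.
split.
- by move=> p [/GAB //|->].
- move=> x y y' [g|[? ?]] [g'|[? ?]]; subst => //; first exact: Gf g g'.
  + by case: nGa; exists y.
  + by case: nGa; exists y'.
- move=> x x' y [g|[? ?]] [g'|[? ?]]; subst => //; first exact: Gi g g'.
  + by case: nGb; exists x.
  + by case: nGb; exists x'.
Qed.

Section Square.
Variable X : Type.

(** The graph of an injection from [D * D] to [D], where [D] is read off from the
diagonal of the domain of [G].  Graphs, unlike pairs of a set and a total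
function, are ordered by inclusion and have unions along chains. *)
Record square_pairing (G : set (X * X * X)) : Prop := SquarePairing {
  sp_fun : forall p z z', G (p, z) -> G (p, z') -> z = z';
  sp_inj : forall p p' z, G (p, z) -> G (p', z) -> p = p';
  sp_dom : forall x y z, G ((x, y), z) -> (exists t, G ((x, x), t)) /\
     (exists t, G ((y, y), t)) /\ (exists t, G ((z, z), t));
  sp_tot : forall x y t u, G ((x, x), t) -> G ((y, y), u) ->
     exists z, G ((x, y), z) }.

Lemma square_pairing_bigcup (F : set (set (X * X * X))) :
  F `<=` square_pairing -> total_on F subset ->
  square_pairing (\bigcup_(G in F) G).
Proof.
move=> FP Ftot.
have big p q : (\bigcup_(G in F) G) p -> (\bigcup_(G in F) G) q ->
    exists2 G, F G & G p /\ G q.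
  move=> [G FG Gp] [H FH Hq]; case: (Ftot _ _ FG FH) => sub.
    by exists H => //; split=> //; apply: sub.
  by exists G => //; split=> //; apply: sub.
split.
- by move=> p z z' h h'; have [G /FP GP [g g']] := big _ _ h h'; apply: sp_fun g g'.
- by move=> p z z' h h'; have [G /FP GP [g g']] := big _ _ h h'; apply: sp_inj g g'.
- move=> x y z [G FG g]; have [[a ga] [[b gb] [c gc]]] := sp_dom (FP _ FG) g.
  by split; [exists a|split; [exists b|exists c]]; exists G.
- move=> x y t u h h'; have [G FG [g g']] := big _ _ h h'.
  by have [z gz] := sp_tot (FP _ FG) g g'; exists z, G.
Qed.

(** Let [h] embed [D] into its complement.  The square of [D `|` h @` D] minus
that of [D] consists of three copies of [D * D], so it embeds into [h @` D]
through [f], once [a], [b] and [c] are used to tell the copies apart. *)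
Lemma square_pairing_extend (G : set (X * X * X)) (D : set X)
    (f : X -> X -> X) (h : X -> X) (a b c : X) :
  square_pairing G ->
  (forall x, D x <-> exists t, G ((x, x), t)) ->
  (forall x y, D x -> D y -> G ((x, y), f x y)) ->
  (forall x, D x -> ~ D (h x)) ->
  (forall x y, D x -> D y -> h x = h y -> x = y) ->
  D a -> D b -> D c -> a <> b -> a <> c -> b <> c ->
  exists2 G', G `<` G' & square_pairing G'.
Proof.
move=> GP DE fG hD hi Da Db Dc ab ac bc.
have GD x y z : G ((x, y), z) -> [/\ D x, D y & D z].
  by move=> /(sp_dom GP)[? [? ?]]; split; apply/DE.
have Df x y : D x -> D y -> D (f x y).
  by move=> Dx Dy; have [] := GD _ _ _ (fG _ _ Dx Dy).
pose D' x := D x \/ exists2 d, D d & x = h d.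
have /choice[r rP] : forall x, exists y, D' x -> D y /\ (x = y \/ x = h y).
  move=> x.
  have [Dx|nDx] := pselect (D x); first by exists x => _; split=> //; left.
  have [[//|[d Dd ->]]|nD'] := pselect (D' x); last by exists x.
  by exists d => _; split=> //; right.
have rD x : D' x -> D x -> x = r x.
  by move=> /rP[Dr [//|->]] /(hD _ Dr).
have rN x : D' x -> ~ D x -> x = h (r x).
  by move=> /rP[Dr [{1}->|//]].
pose tau x y := if `[< D x >] then a else if `[< D y >] then b else c.
have Dtau x y : D (tau x y).
  by rewrite /tau; case: asboolP => // _; case: asboolP.
pose g x y := h (f (tau x y) (f (r x) (r y))).
have fi x y x' y' : D x -> D y -> D x' -> D y' -> f x y = f x' y' ->
    x = x' /\ y = y'.
  move=> Dx Dy Dx' Dy' e; have := fG _ _ Dx' Dy'; rewrite -e => g'.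
  by have [-> ->] := sp_inj GP (fG _ _ Dx Dy) g'.
pose new (q : X * X * X) := [/\ D' q.1.1, D' q.1.2, ~ (D q.1.1 /\ D q.1.2)
  & q.2 = g q.1.1 q.1.2].
have gD x y : D' x -> D' y -> exists2 d, D d & g x y = h d.
  move=> /rP[Dx _] /rP[Dy _]; exists (f (tau x y) (f (r x) (r y))) => //.
  by have [] := GD _ _ _ (fG _ _ (Dtau x y) (Df _ _ Dx Dy)).
have GnD x y z : (G `|` new) ((x, y), z) -> [/\ D' x, D' y & D' z].
  case=> [/GD[? ? ?]|[/= ? ? _ ->]]; first by split; left.
  by split=> //; right; apply: gD.
have dom x : D' x -> exists t, (G `|` new) ((x, x), t).
  move=> D'x; have [/DE[t Gt]|nD] := pselect (D x); first by exists t; left.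
  by exists (g x x); right; split=> //= -[].
exists (G `|` new).
  split; first by move=> q; left.
  have D'h : D' (h a) by right; exists a.
  have nDh := hD _ Da.
  move=> /(_ ((h a, h a), g (h a) (h a))) H; apply: (nDh).
  suff [] : [/\ D (h a), D (h a) & D (g (h a) (h a))] by [].
  by apply: GD; apply: H; right; split => //= -[].
split.
- move=> [x y] z z' [G1|[/= ? ? nD e1]] [G2|[/= ? ? nD' e2]].
  + exact: (sp_fun GP G1 G2).
  + by case: nD'; have [] := GD _ _ _ G1.
  + by case: nD; have [] := GD _ _ _ G2.
  + by rewrite e1 e2.
- move=> [x y] [x' y'] z [G1|[/= Dx Dy nD e1]] [G2|[/= Dx' Dy' nD' e2]].
  + exact: (sp_inj GP G1 G2).
  + have [_ _] := GD _ _ _ G1; rewrite e2.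
    by have [d Dd ->] := gD _ _ Dx' Dy'; case/(hD _ Dd).
  + have [_ _] := GD _ _ _ G2; rewrite e1.
    by have [d Dd ->] := gD _ _ Dx Dy; case/(hD _ Dd).
  have [[[[rx _] [ry _]] [rx' _]] [ry' _]] := (rP _ Dx, rP _ Dy, rP _ Dx', rP _ Dy').
  have [etau er] : tau x y = tau x' y' /\ f (r x) (r y) = f (r x') (r y').
    by apply: (fi); auto; apply: hi; auto; exact: (etrans (esym e1) e2).
  have [ex ey] : r x = r x' /\ r y = r y' by apply: (fi).
  have [eDx eDy] : `[< D x >] = `[< D x' >] /\ `[< D y >] = `[< D y' >].
    move: etau nD nD'; rewrite /tau.
    by case: (asboolP (D x)) => ?; case: (asboolP (D y)) => ?;
      case: (asboolP (D x')) => ?; case: (asboolP (D y')) => ? //= e nD nD';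
      first [by split | by case: nD; split | by case: nD'; split
        | by case: ab | by case: ac | by case: bc].
  have same u u' : D' u -> D' u' -> r u = r u' -> `[< D u >] = `[< D u' >] -> u = u'.
    move=> Du Du' e; case: (asboolP (D u)) => d; case: (asboolP (D u')) => d' // _.
      by rewrite (rD _ Du d) (rD _ Du' d').
    by rewrite (rN _ Du d) (rN _ Du' d') e.
  by rewrite (same x x') // (same y y').
- by move=> x y z /GnD[/dom ? /dom ? /dom ?].
- move=> x y t u /GnD[D'x _ _] /GnD[D'y _ _].
  have [[Dx Dy]|nD] := pselect (D x /\ D y).
    by exists (f x y); left; apply: fG.
  by exists (g x y); right; split.
Qed.

(** Hessenberg's theorem.  Let [D] be the set underlying a maximal pairing.  If
[D] embedded into its complement, the pairing could be extended; so the
complement embeds into [D], hence [X] into two copies of [D], hence into [D]. *)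
Lemma embeds_square : embeds nat X -> embeds (X * X) X.
Proof.
move=> [e ei].
have [pr prI] : embeds (nat * nat) nat by exists pickle; apply: pcan_inj pickleK.
pose base : set (X * X * X) :=
  [set q | exists m n, q = ((e m, e n), e (pr (m, n)))].
have baseP : square_pairing base.
  split.
  - move=> p z z' [m [n [-> ->]]] [m' [n' [/ei -> /ei -> ->]]] //.
  - by move=> p p' z [m [n [-> ->]]] [m' [n' [-> /ei /prI[-> ->]]]].
  - move=> x y z [m [n [-> -> ->]]].
    by split; [|split]; eexists; eexists; eexists.
  - by move=> x y t u [m [_ [-> _ _]]] [n [_ [-> _ _]]]; eexists; exists m, n.
pose P G := square_pairing G /\ (G = set0 \/ base `<=` G).
have [|G [[GP Gbase] Gmax]] := @Zorn_bigcup _ P.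
  move=> F FP Ftot; split.
    by apply: square_pairing_bigcup => // G /FP[].
  have [all0|] := pselect (forall G, F G -> G = set0).
    by left; apply/seteqP; split=> // q [G /all0 ->].
  move=> /existsNP[G /not_implyP[FG nG]]; right => q bq.
  by exists G => //; case: (FP _ FG) => _ [//|]; apply.
have {}Gbase : base `<=` G.
  case: Gbase => // G0; exfalso; apply: (Gmax base); last by split=> //; right.
  rewrite G0; split=> // /(_ ((e 0%N, e 0%N), e (pr (0%N, 0%N)))); apply.
  by exists 0%N, 0%N.
pose D x := exists t, G ((x, x), t).
have De n : D (e n) by exists (e (pr (n, n))); apply: Gbase; exists n, n.
have [f fG] : exists f : X -> X -> X, forall x y, D x -> D y -> G ((x, y), f x y).
  have /choice[f fP] : forall p, exists z, D p.1 -> D p.2 -> G (p, z).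
    move=> [x y] /=.
    have [[t Gt]|nD] := pselect (D x); last by exists x.
    have [[u Gu]|nD] := pselect (D y); last by exists x.
    by have [z Gz] := sp_tot GP Gt Gu; exists z.
  by exists (fun x y => f (x, y)) => x y Dx Dy; apply: fP.
have Df x y : D x -> D y -> D (f x y).
  by move=> Dx Dy; have [_ [_]] := sp_dom GP (fG _ _ Dx Dy).
have fi x y x' y' : D x -> D y -> D x' -> D y' -> f x y = f x' y' ->
    x = x' /\ y = y'.
  move=> Dx Dy Dx' Dy' E; have := fG _ _ Dx' Dy'; rewrite -E => g'.
  by have [-> ->] := sp_inj GP (fG _ _ Dx Dy) g'.
have ne m n : m != n -> e m <> e n by move=> /eqP mn /ei.
have [[h [hD hi]]|[h [hD hi]]] := set_comparable D (~` D).
  exfalso.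
  have [G' GG' G'P] : exists2 G', G `<` G' & square_pairing G'.
    by apply: (@square_pairing_extend G D f h (e 0%N) (e 1%N) (e 2%N)) => //;
      apply: ne.
  apply: (Gmax _ GG'); split=> //; right.
  by move=> q /Gbase; apply: (properW GG').
pose iota x := if `[< D x >] then f (e 0%N) x else f (e 1%N) (h x).
have iD x : D (iota x).
  by rewrite /iota; case: asboolP => Dx; apply: Df => //; apply: hD.
have ii : injective iota.
  move=> x y; rewrite /iota.
  case: asboolP => Dx; case: asboolP => Dy.
  - by move=> /fi[] //.
  - by move=> /fi[] //; [apply: hD | move=> /ei].
  - by move=> /fi[] //; [apply: hD | move=> /ei].
  - by move=> /fi[] //; [apply: hD.. | move=> _ /hi; apply].
exists (fun p => f (iota p.1) (iota p.2)) => -[x y] [x' y'] /=.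
by move=> /fi[] // /ii -> /ii ->.
Qed.

End Square.

(** * Small sets *)

Section Small.
Variable K : Type.

(** [small A] means [|A| <= |K|]; a function on the whole type, injective on [A],
spares the choice of a subtype. *)
Definition small (X : Type) (A : set X) : Prop :=
  exists f : X -> K, forall x y, A x -> A y -> f x = f y -> x = y.

Lemma small_sub (X : Type) (A B : set X) : A `<=` B -> small B -> small A.
Proof. by move=> AB [f fi]; exists f => x y /AB Bx /AB By; apply: fi. Qed.

Lemma small_embeds (X : Type) : small [set: X] <-> embeds X K.
Proof. by split=> -[f fi]; exists f => x y; [apply: fi | move=> _ _ /fi]. Qed.

Hypothesis KN : embeds nat K.

Lemma small_image (X Y : Type) (A : set X) (f : X -> Y) :
  small A -> small (f @` A).
Proof.
case: KN => k _ [g gi].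
have /choice[h hP] : forall y, exists c, (f @` A) y ->
    exists2 x, A x & f x = y /\ g x = c.
  move=> y; have [[x Ax fx]|nA] := pselect ((f @` A) y); last by exists (k 0%N).
  by exists (g x) => _; exists x.
exists h => y y' /hP[x Ax [<- gx]] /hP[x' Ax' [<- gx']] e.
by rewrite (gi x x') // gx gx'.
Qed.

Lemma small_countable (X : countType) (A : set X) : small A.
Proof.
case: KN => k ki; exists (k \o pickle) => x y _ _ /ki; exact: (pcan_inj pickleK).
Qed.

Hypothesis KK : embeds (K * K) K.

(** A point of the union is coded by the code of an index [i] with [F i x], paired
with the code of [x] in [F i]. *)
Lemma small_bigcup (I X : Type) (D : set I) (F : I -> set X) :
  small D -> (forall i, D i -> small (F i)) -> small (\bigcup_(i in D) F i).
Proof.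
case: KN => k _; case: KK => q qi [d di] sF.
have /choice[f fP] : forall i, exists f : X -> K, D i ->
    forall x y, F i x -> F i y -> f x = f y -> x = y.
  move=> i; have [/sF[f fi]|nD] := pselect (D i); first by exists f.
  by exists (fun=> k 0%N).
have /choice[g gP] : forall x, exists c, (\bigcup_(i in D) F i) x ->
    exists2 i, D i & F i x /\ c = q (d i, f i x).
  move=> x; have [[i Di Fx]|nU] := pselect ((\bigcup_(i in D) F i) x).
    by exists (q (d i, f i x)) => _; exists i.
  by exists (k 0%N).
exists g => x y /gP[i Di [Fx ->]] /gP[j Dj [Fy ->]] /qi[/(di _ _ Di Dj) ij].
by subst j; apply: fP.
Qed.

Lemma small_pair (X Y : Type) (A : set X) (B : set Y) :
  small A -> small B -> small (A `*` B).
Proof.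
move=> sA sB; apply: (@small_sub _ _ (\bigcup_(x in A) (pair x @` B))).
  by move=> [x y] [/= Ax By]; exists x => //; exists y.
by apply: small_bigcup => // x _; apply: small_image.
Qed.

Lemma small_seq (X : eqType) (A : set X) :
  small A -> small [set s : seq X | forall x, x \in s -> A x].
Proof.
move=> sA; pose L n := [set s : seq X | size s = n /\ forall x, x \in s -> A x].
apply: (@small_sub _ _ (\bigcup_(n in [set: nat]) L n)).
  by move=> s sA'; exists (size s).
apply: small_bigcup => [|n _]; first exact: small_countable.
elim: n => [|n IHn].
  apply: (@small_sub _ _ ((fun=> [::]) @` [set: nat])).
    by case=> [|x s] [/= s0 _] //; exists 0%N.
  by apply: small_image; apply: small_countable.
apply: (@small_sub _ _ ((fun p => p.1 :: p.2) @` (A `*` L n))).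
  case=> [|x s] [/= ss As]; first by [].
  exists (x, s) => //=; split=> /=.
    by apply: As; rewrite mem_head.
  by split=> [|y ys]; [by case: ss|]; apply: As; rewrite inE ys orbT.
apply: small_image; exact: small_pair.
Qed.

End Small.

(** * Ideals of Noetherian rings *)

(** Compactness of chains: finitely many points of a union along a chain lie in
one member. *)
Lemma chain_seq (X : eqType) (F : set (set X)) (r : seq X) :
  total_on F subset -> F !=set0 ->
  (forall x : X, x \in r -> (\bigcup_(G in F) G) x) ->
  exists2 G, F G & forall x : X, x \in r -> G x.
Proof.
move=> Ftot [G0 FG0]; elim: r => [|a r IHr] rF; first by exists G0.
have [|G FG Gr] := IHr; first by move=> x xr; apply: rF; rewrite inE xr orbT.
have [H FH Ha] := rF a (mem_head _ _).
have [GH|HG] := Ftot _ _ FG FH; [exists H | exists G] => // x;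
  rewrite inE => /orP[/eqP -> //|/Gr Gx]; by [apply: GH | apply: HG | ].
Qed.

Section Spans.
Variable R : comNzRingType.
Implicit Types (B I J S : set R) (s : seq R) (x y : R).

(** The unit ideal is allowed.  Sets of this kind are used in place of boolean
predicates for ideals that arise inside proofs. *)
Record is_ideal I : Prop := IsIdeal {
  is_ideal0 : I 0;
  is_idealD : forall x y, I x -> I y -> I (x + y);
  is_idealM : forall a x, I x -> I (a * x) }.

Lemma is_idealB I x y : is_ideal I -> I x -> I y -> I (x - y).
Proof. by move=> II Ix Iy; apply: is_idealD => //; rewrite -mulN1r; apply: is_idealM. Qed.

Lemma is_ideal_ideal I : is_ideal I -> ideal [pred x | `[< I x >]].
Proof.
move=> [I0 ID IM]; split; first exact/asboolP.
  by move=> x y /asboolP Ix /asboolP Iy; apply/asboolP/ID.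
by move=> a x /asboolP Ix; apply/asboolP/IM.
Qed.

Lemma ideal_is_ideal (J : {pred R}) : ideal J -> is_ideal [set x | x \in J].
Proof. by move=> [J0 JD JM]; split. Qed.

Lemma idealr_is_ideal (J : idealr R) : is_ideal [set x | x \in J].
Proof. by split=> [|x y /= Jx Jy|a x /= Jx] /=; rewrite ?rpred0 ?rpredD ?idealMr. Qed.

(** Linear combinations of [s] with coefficients in [B].  The recursion isolates
the coefficient of the first generator, as arguments that treat one generator
at a time need; [lin_sumP] recovers the usual sums. *)
Fixpoint lin B s : set R :=
  if s is a :: s' then
    [set x | exists c y, [/\ B c, lin B s' y & x = c * a + y]]
  else [set 0].

Lemma lin_sumP s x :
  lin setT s x <-> exists c : 'I_(size s) -> R, x = \sum_(i < size s) c i * s`_i.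
Proof.
elim: s x => [|a s IHs] x /=.
  split=> [->|[c ->]]; last by rewrite big_ord0.
  by exists (fun=> 0); rewrite big_ord0.
split=> [[c [y [_ /IHs[d ->] ->]]]|[d ->]].
  exists (fun i => if unlift ord0 i is Some j then d j else c).
  rewrite big_ord_recl unlift_none; congr (_ + _); apply: eq_bigr => i _.
  by rewrite liftK.
exists (d ord0), (\sum_(i < size s) d (lift ord0 i) * s`_i); split=> //.
  by apply/IHs; exists (fun i => d (lift ord0 i)).
by rewrite big_ord_recl.
Qed.

Lemma lin_is_ideal s : is_ideal (lin setT s).
Proof.
elim: s => [|a s IHs]; split=> /=.
- by [].
- by move=> x y -> ->; rewrite addr0.
- by move=> b x ->; rewrite mulr0.
- by exists 0, 0; split=> //; [apply: is_ideal0 | rewrite mul0r addr0].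
- move=> x y [c [u [_ lu ->]]] [d [v [_ lv ->]]]; exists (c + d), (u + v).
  by split=> //; [apply: is_idealD | rewrite mulrDl addrACA].
- move=> b x [c [u [_ lu ->]]]; exists (b * c), (b * u).
  by split=> //; [apply: is_idealM | rewrite mulrDr mulrA].
Qed.

Lemma lin_mem s x : x \in s -> lin setT s x.
Proof.
elim: s => // a s IHs; rewrite inE => /orP[/eqP ->|/IHs xs] /=.
  by exists 1, 0; split=> //; [apply: is_ideal0 (lin_is_ideal s) | rewrite mul1r addr0].
by exists 0, x; split=> //; rewrite mul0r add0r.
Qed.

Lemma lin_min I s : is_ideal I -> (forall x, x \in s -> I x) -> lin setT s `<=` I.
Proof.
move=> II; elim: s => [|a s IHs] sI x /=; first by move=> ->; apply: is_ideal0.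
move=> [c [y [_ ly ->]]]; apply: is_idealD => //.
  by apply: is_idealM => //; apply: sI; rewrite mem_head.
by apply: IHs => // z zs; apply: sI; rewrite inE zs orbT.
Qed.

Lemma lin_subset B B' s : B `<=` B' -> lin B s `<=` lin B' s.
Proof.
move=> BB'; elim: s => [|a s IHs] x //= [c [y [Bc ly ->]]].
by exists c, y; split=> //; [apply: BB' | apply: IHs].
Qed.

Definition span S : set R :=
  [set x | exists2 s, (forall y, y \in s -> S y) & lin setT s x].

Lemma span_sub S : S `<=` span S.
Proof.
move=> x Sx; exists [:: x]; first by move=> y; rewrite inE => /eqP ->.
by apply: lin_mem; rewrite mem_head.
Qed.

Lemma span_is_ideal S : is_ideal (span S).
Proof.
split.
- by exists [::].
- move=> x y [s sS lx] [t tS ly]; exists (s ++ t).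
    by move=> z; rewrite mem_cat => /orP[/sS|/tS].
  apply: is_idealD; first exact: lin_is_ideal.
    apply: lin_min lx; first exact: lin_is_ideal.
    by move=> z zs; apply: lin_mem; rewrite mem_cat zs.
  apply: lin_min ly; first exact: lin_is_ideal.
  by move=> z zs; apply: lin_mem; rewrite mem_cat zs orbT.
- by move=> a x [s sS lx]; exists s => //; apply: is_idealM => //; apply: lin_is_ideal.
Qed.

Lemma span_min I S : is_ideal I -> S `<=` I -> span S `<=` I.
Proof. by move=> II SI x [s sS lx]; apply: lin_min lx => // y /sS /SI. Qed.

(** Over a Noetherian ring, generators of an ideal may be chosen within any
prescribed set of generators: each element of a finite generating sequence
involves finitely many prescribed ones. *)
Lemma noetherian_span S : noetherian R ->
  exists2 s, (forall y, y \in s -> S y) & span S `<=` lin setT s.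
Proof.
move=> /(_ _ (is_ideal_ideal (span_is_ideal S)))[g gP].
have gS x : x \in g -> span S x.
  by move=> xg; have /asboolP := (gP x).2 ((lin_sumP _ _).1 (lin_mem xg)).
have [s sS gs] : exists2 s, (forall y, y \in s -> S y) &
    forall x, x \in g -> lin setT s x.
  elim: g gS {gP} => [|a g IHg] gS; first by exists [::].
  have [|s sS gs] := IHg; first by move=> x xg; apply: gS; rewrite inE xg orbT.
  have [t tS la] := gS a (mem_head _ _).
  exists (t ++ s); first by move=> y; rewrite mem_cat => /orP[/tS|/sS].
  move=> x; rewrite inE => /orP[/eqP ->|/gs lx].
    apply: lin_min la; first exact: lin_is_ideal.
    by move=> z zs; apply: lin_mem; rewrite mem_cat zs.
  apply: lin_min lx; first exact: lin_is_ideal.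
  by move=> z zs; apply: lin_mem; rewrite mem_cat zs orbT.
exists s => // x /asboolP /(gP x).1 /lin_sumP lx.
by apply: lin_min lx; first exact: lin_is_ideal.
Qed.

(** The union of a chain of ideals is finitely generated, hence equal to a member
of the chain, so Zorn's lemma applies. *)
Lemma noetherian_max (P : set (set R)) I0 : noetherian R -> P I0 ->
  (forall I, P I -> is_ideal I) ->
  exists2 I, P I & forall J, P J -> I `<=` J -> J `<=` I.
Proof.
move=> nR PI0 PI.
pose r (Y Z : {I | P I}) := `[< sval Y `<=` sval Z >].
have [|||[I PI1] Imax] := @ZL_preorder _ (exist P I0 PI0) r.
- by move=> I; apply/asboolP.
- by move=> I J L /asboolP IJ /asboolP JL; apply/asboolP => x /IJ /JL.
- move=> C Ctot.
  have [[I1 CI1]|C0] := pselect (exists Z, C Z); last first.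
    by exists (exist P I0 PI0) => I CI; case: C0; exists I.
  pose F : set (set R) := [set sval Z | Z in C].
  have Ftot : total_on F subset.
    by move=> _ _ [I CI <-] [J CJ <-]; case: (Ctot _ _ CI CJ) => /asboolP; [left|right].
  have [s sF Fs] := noetherian_span (\bigcup_(G in F) G) nR.
  have Fn0 : F !=set0 by exists (sval I1), I1.
  have [G [I CI <-] Is] := chain_seq Ftot Fn0 sF.
  exists I => J CJ; apply/asboolP => x Jx.
  apply: (lin_min (PI _ (svalP I)) Is); apply: Fs; apply: span_sub.
  by exists (sval J) => //; exists J.
exists I => // J PJ IJ; have := Imax (exist P J PJ).
by move=> /(_ (asboolT IJ)) /asboolP.
Qed.

End Spans.

Section Powers.
Variables (R : comNzRingType) (I : idealr R).

Lemma ideal_pow_prod n (s : seq R) : size s = n -> {subset s <= I} ->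
  \prod_(x <- s) x \in ideal_pow I n.
Proof.
move=> <- sI; apply/ideal_powP; exists 1%N, (fun=> 1), (fun _ j => s`_j).
split; first by move=> _ j; apply: sI; apply: mem_nth.
by rewrite big_ord1 mul1r (big_nth 0) big_mkord.
Qed.

(** Universal property of the power: it reduces statements about [I^n] to
products of [n] elements of [I]. *)
Lemma ideal_pow_min n (J : set R) : is_ideal J ->
  (forall s, size s = n -> {subset s <= I} -> J (\prod_(x <- s) x)) ->
  forall x, x \in ideal_pow I n -> J x.
Proof.
move=> JJ sJ x /ideal_powP[k [c [a [aI ->]]]].
elim/big_ind: _ => [|u v|i _]; [exact: is_ideal0 | exact: is_idealD |].
apply: is_idealM => //.
have -> : \prod_(j < n) a i j = \prod_(x <- codom (a i)) x.
  by rewrite /codom /image_mem big_map big_enum.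
by apply: sJ; [rewrite size_codom card_ord | move=> _ /codomP[j ->]].
Qed.

Lemma ideal_pow0 x : x \in ideal_pow I 0.
Proof.
apply/ideal_powP; exists 1%N, (fun=> x), (fun _ => fun=> 0).
by split=> [_ []//|]; rewrite big_ord1 big_ord0 mulr1.
Qed.

Lemma ideal_pow_is_ideal n : is_ideal [set x | x \in ideal_pow I n].
Proof.
case: n => [|n]; first by split=> *; apply: ideal_pow0.
exact: (idealr_is_ideal (ideal_pow I n.+1)).
Qed.

Lemma ideal_powM m n x y : x \in ideal_pow I m -> y \in ideal_pow I n ->
  x * y \in ideal_pow I (m + n).
Proof.
have [p0 pD pM] := ideal_pow_is_ideal (m + n).
move=> + yn; move: x; apply: ideal_pow_min => [|s ss sI].
  split=> [|u v /= Iu Iv|a u Iu] /=; first by rewrite mul0r.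
    by rewrite mulrDl; apply: pD.
  by rewrite -mulrA; apply: pM.
move: y yn; apply: ideal_pow_min => [|t st tI].
  split=> [|u v /= Iu Iv|a u Iu] /=; first by rewrite mulr0.
    by rewrite mulrDr; apply: pD.
  by rewrite mulrCA; apply: pM.
rewrite -big_cat; apply: ideal_pow_prod; first by rewrite size_cat ss st.
by move=> x; rewrite mem_cat => /orP[/sI|/tI].
Qed.

Lemma ideal_pow1 x : (x \in ideal_pow I 1) = (x \in I).
Proof.
apply/idP/idP => [/ideal_pow_sub //|Ix].
have := @ideal_pow_prod 1 [:: x] erefl; rewrite big_seq1; apply.
by move=> y; rewrite inE => /eqP ->.
Qed.

Lemma ideal_pow_le m n : (m <= n)%N -> {subset ideal_pow I n <= ideal_pow I m}.
Proof.
move=> /subnK <-; elim: (n - m)%N => // k IHk x.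
by rewrite addSn => /ideal_pow_decr /IHk.
Qed.

Lemma ideal_powS n x y : x \in I -> y \in ideal_pow I n -> x * y \in ideal_pow I n.+1.
Proof. by rewrite -ideal_pow1 => xI yI; rewrite -add1n ideal_powM. Qed.

End Powers.

(** * Intersecting powers of an ideal with a principal ideal *)

Section KrullRees.
Variables (R : comNzRingType) (I : idealr R).
Hypothesis noethR : noetherian R.

(** One generator [a] of [I] is removed at a time.  If products of [n] elements
of [I] lie in [N' + (a)], with [a ^+ e] in [N'], then products of [e * n]
elements lie in [N' + (a ^+ e)], which is [N']. *)
Lemma power_sub_of_nil (N : set R) : is_ideal N ->
  (forall x, x \in I -> exists e, N (x ^+ e)) ->
  exists n, forall x, x \in ideal_pow I n -> N x.
Proof.
move=> NN nilI.
suff [n nP] : exists n, forall p : seq R, size p = n -> {subset p <= I} ->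
    N (\prod_(x <- p) x).
  by exists n; apply: ideal_pow_min.
have [s sI Is] := noetherian_span [set x | x \in I] noethR.
have {Is} : exists n, forall p : seq R, size p = n -> {subset p <= I} ->
    exists2 u, N u & lin setT s (\prod_(x <- p) x - u).
  exists 1%N => -[|x [|//]] // _ xI; exists 0; first exact: is_ideal0.
  rewrite big_seq1 subr0; apply: Is; apply: span_sub.
  by apply: xI; rewrite mem_head.
elim: s N NN nilI sI => [|a s IHs] N NN nilI sI [n nP].
  by exists n => p sp pI; have [u Nu /= /eqP] := nP p sp pI; rewrite subr_eq0 => /eqP ->.
have [e Nae] := nilI a (sI a (mem_head _ _)).
have [||||n' n'P] := IHs N.
- by [].
- by [].
- by move=> y ys; apply: sI; rewrite inE ys orbT.
- pose N' := [set x | exists2 u, N u & lin setT s (x - u)].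
  have linN := lin_is_ideal s.
  have NN' : is_ideal N'.
    split.
    + by exists 0; [exact: is_ideal0 | rewrite subrr; exact: is_ideal0].
    + move=> x y [u Nu lu] [v Nv lv]; exists (u + v); first exact: is_idealD.
      by rewrite opprD addrACA; apply: is_idealD.
    + move=> b x [u Nu lu]; exists (b * u); first exact: is_idealM.
      by rewrite -mulrBr; apply: is_idealM.
  (* Products of [i * n] elements lie in [N' + (a ^+ i)]. *)
  suff pow i p : size p = (i * n)%N -> {subset p <= I} ->
      exists c, N' (\prod_(x <- p) x - c * a ^+ i).
    exists (e * n)%N => p sp pI; have [c [u Nu lu]] := pow _ p sp pI.
    exists (u + c * a ^+ e); first by apply: is_idealD => //; apply: is_idealM.
    by rewrite [u + _]addrC opprD addrA.
  elim: i p => [|i IHi] p sp pI.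
    exists (\prod_(x <- p) x); rewrite expr0 mulr1 subrr; exact: is_ideal0.
  rewrite -(cat_take_drop n p) big_cat /=.
  have st : size (take n p) = n by rewrite size_takel // sp mulSn leq_addr.
  have sd : size (drop n p) = (i * n)%N by rewrite size_drop sp mulSn addKn.
  have [|u Nu [c [y [_ ly e1]]]] := nP _ st; first by move=> x /mem_take /pI.
  have [|d Nd] := IHi _ sd; first by move=> x /mem_drop /pI.
  move: e1 Nd; set P := \prod_(x <- take n p) x; set Q := \prod_(x <- drop n p) x.
  move=> /eqP; rewrite subr_eq => /eqP -> Nd.
  exists (c * d).
  have -> : (c * a + y + u) * Q - c * d * a ^+ i.+1 =
      c * a * (Q - d * a ^+ i) + Q * (y + u).
    rewrite mulrBr [Q * _]mulrC -!addrA mulrDl -!addrA; congr (_ + _).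
    by rewrite addrC exprS mulrACA.
  apply: is_idealD => //; apply: is_idealM => //.
  by exists u; rewrite ?addrK.
by exists n'.
Qed.

(** A weak form of the Artin-Rees lemma, [(a) ∩ I^n ⊆ a I^k] for some [n], by an
argument of Krull.  Let [N] be maximal among the ideals that contain [a I^k] and
meet [(a)] in nothing more.  If [x] is in [I] and [(N : x^n)] has
stabilized, then [N + (x^n)] has the same property: an element [u + x^n v] of
[(a)] is sent into [a I^k] by [x^k], so [x^(k+n) v] is in [N] and hence so is
[x^n v].  By maximality [N] contains a power of every element of [I], and thus
a power of [I]. *)
Lemma principal_cap_power (a : R) k :
  exists n, forall x, a * x \in ideal_pow I n ->
    exists2 y, y \in ideal_pow I k & a * x = a * y.
Proof.
pose B := [set a * y | y in [set y | y \in ideal_pow I k]].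
have [p0 pD pM] := ideal_pow_is_ideal I k.
have BB : is_ideal B.
  split; first by exists 0; rewrite ?mulr0.
  - by move=> _ _ [y yI <-] [z zI <-]; exists (y + z); rewrite ?mulrDr //; apply: pD.
  - by move=> b _ [y yI <-]; exists (b * y); [apply: pM | rewrite mulrCA].
pose P (N : set R) := [/\ is_ideal N, B `<=` N & forall x, N (a * x) -> B (a * x)].
have [||N [NN BN NB] Nmax] := @noetherian_max R P B noethR.
- by split.
- by move=> N [].
have [n nN] : exists n, forall x, x \in ideal_pow I n -> N x.
  apply: power_sub_of_nil => // x xI.
  pose C := [set [set v | N (x ^+ i * v)] | i in [set: nat]].
  have [||_ [n _ <-] nmax] := @noetherian_max R C [set v | N (x ^+ 0 * v)] noethR.
    by exists 0%N.
    move=> _ [i _ <-]; split=> [|u v /= Nu Nv|b u /= Nu] /=.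
    - by rewrite mulr0; apply: is_ideal0.
    - by rewrite mulrDr; apply: is_idealD.
    - by rewrite mulrCA; apply: is_idealM.
  (* [N2] is [N + (x ^+ n)]. *)
  pose N2 := [set y | exists u v, N u /\ y = u + x ^+ n * v].
  exists n; apply: (Nmax N2); last 1 first.
  - by exists 0, 1; rewrite mulr1 add0r; split=> //; apply: is_ideal0.
  - split.
    + split.
      * by exists 0, 0; rewrite mulr0 addr0; split=> //; apply: is_ideal0.
      * move=> _ _ [u [v [Nu ->]]] [u' [v' [Nu' ->]]]; exists (u + u'), (v + v').
        by rewrite mulrDr addrACA; split=> //; apply: is_idealD.
      * move=> b _ [u [v [Nu ->]]]; exists (b * u), (b * v).
        by rewrite mulrDr mulrCA; split=> //; apply: is_idealM.
    + by move=> y By; exists y, 0; rewrite mulr0 addr0; split=> //; apply: BN.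
    + move=> w [u [v [Nu e]]]; apply: NB.
      rewrite e; apply: is_idealD => //.
      apply: (nmax [set v | N (x ^+ (k + n) * v)]).
      * by exists (k + n)%N.
      * by move=> t /= Nt; rewrite exprD -mulrA; apply: is_idealM.
      rewrite /=; have -> : x ^+ (k + n) * v = a * (x ^+ k * w) - x ^+ k * u.
        by rewrite mulrCA -mulrBr e addrAC subrr add0r exprD mulrA.
      apply: is_idealB => //; last exact: is_idealM.
      apply: BN; exists (x ^+ k * w) => //=.
      rewrite mulrC; apply: pM.
      have := @ideal_pow_prod _ I k (nseq k x) (size_nseq _ _).
      rewrite big_nseq iter_mulr_1; apply.
      by move=> y /nseqP[-> _].
  - by move=> y Ny; exists y, 0; rewrite mulr0 addr0.
exists n => x /nN /NB [y yI <-]; by exists y.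
Qed.

End KrullRees.

(** * Local rings and completions *)

(** Packages a set that is a proper ideal as an [idealr], the type over which
maximal ideals are quantified. *)
Definition ideal_pred (R : comNzRingType) (J : set R)
  (JJ : is_ideal J) (J1 : ~ J 1) : {pred R} := [pred x | `[< J x >]].

Lemma ideal_pred_closed (R : comNzRingType) (J : set R)
  (JJ : is_ideal J) (J1 : ~ J 1) : idealr_closed (ideal_pred JJ J1).
Proof.
split; [exact/asboolP/(is_ideal0 JJ) | by apply/negP => /asboolP |].
move=> a u v /asboolP Ju /asboolP Jv; apply/asboolP.
by apply: is_idealD => //; apply: is_idealM.
Qed.

HB.instance Definition _ (R : comNzRingType) J JJ J1 :=
  isIdealr.Build R (@ideal_pred R J JJ J1) (ideal_pred_closed JJ J1).

(** Otherwise the multiples of [x] lie in a proper ideal; a maximal proper one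
among those containing [x] is a maximal ideal, so it equals [M]. *)
Lemma local_unit (R : comNzRingType) (M : idealr R) : local_ring M ->
  forall x, x \notin M -> exists y, x * y = 1.
Proof.
move=> [nR _ Muniq] x xM.
have [//|nunit] := pselect (exists y, x * y = 1).
pose P (J : set R) := [/\ is_ideal J, J x & ~ J 1].
pose J0 : set R := [set z | exists y, z = x * y].
have [||N [NN Nx N1] Nmax] := @noetherian_max R P J0 nR.
- split; first split.
  + by exists 0; rewrite mulr0.
  + by move=> _ _ [y ->] [z ->]; exists (y + z); rewrite mulrDr.
  + by move=> a _ [y ->]; exists (a * y); rewrite mulrCA.
  + by exists 1; rewrite mulr1.
  + by move=> [y e]; apply: nunit; exists y.
- by move=> J [].
have : maximal_ideal (ideal_pred NN N1).
  move=> J NJ z; apply/idP/idP => [Jz|]; last exact: NJ.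
  apply/asboolP; apply: (Nmax [set z | z \in J]) => //.
    split; first exact: idealr_is_ideal.
      by apply: NJ; apply/asboolP.
    by rewrite /= idealr1.
  by move=> u Nu; apply: NJ; apply/asboolP.
move=> /Muniq NM; case/negP: xM; rewrite -NM; exact/asboolP.
Qed.

Section Completion.
Variables (R : comNzRingType) (I : idealr R).
Implicit Types (F G : adic_completion I).

Lemma completionP F G : (forall n, adic_val F n = adic_val G n) -> F = G.
Proof. by move=> e; apply: val_inj; apply: functional_extensionality_dep. Qed.

Lemma adic_coherentE F k n : (k <= n)%N -> adic_val F k = adic_pi I k (repr (adic_val F n)).
Proof.
move=> /subnK <-; elim: (n - k)%N => [|j IHj]; first by rewrite add0n adic_piK.
rewrite IHj -(adic_coherentP _ (adic_valP F)).
apply/adic_pi_eqP; apply: (@ideal_pow_le _ _ k.+1 (j + k).+1); first by rewrite ltnS leq_addl.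
by apply/adic_pi_eqP; rewrite adic_piK.
Qed.

Lemma to_completion_is_zmod_morphism : zmod_morphism (@to_completion R I).
Proof. by move=> x y; apply: completionP => n; exact: (rmorphB (adic_pi I n)). Qed.

Lemma to_completion_is_monoid_morphism : monoid_morphism (@to_completion R I).
Proof.
split; first by apply: completionP => n; exact: (rmorph1 (adic_pi I n)).
by move=> x y; apply: completionP => n; exact: (rmorphM (adic_pi I n)).
Qed.

HB.instance Definition _ := GRing.isZmodMorphism.Build R (adic_completion I)
  (@to_completion R I) to_completion_is_zmod_morphism.
HB.instance Definition _ := GRing.isMonoidMorphism.Build R (adic_completion I)
  (@to_completion R I) to_completion_is_monoid_morphism.

Lemma adic_pi_eq0 n x : (adic_pi I n x == 0) = (x \in ideal_pow I n.+1).
Proof.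
rewrite -(rmorph0 (adic_pi I n)) -[x in RHS]subr0.
by apply/eqP/idP => /adic_pi_eqP.
Qed.

End Completion.

(** If [a F = 0] then [a x] lies in [m^n], where [x] represents a late component
of [F].  By [principal_cap_power] this puts [x] in a prescribed power of [m]. *)
Lemma completion_regular (A : idomainType) (m : idealr A) (a : A)
    (F : adic_completion m) :
  noetherian A -> a != 0 -> to_completion m a * F = 0 -> F = 0.
Proof.
move=> nA a0 aF; apply: completionP => k.
have [n nP] := principal_cap_power m nA a k.+1.
set x := repr (adic_val F (maxn n k)).
have aFn : adic_pi m (maxn n k) (a * x) = 0.
  transitivity (adic_pi m (maxn n k) a * adic_pi m (maxn n k) x); first exact: rmorphM.
  rewrite /x (adic_piK (adic_val F (maxn n k))).
  exact: (congr1 (fun G : adic_completion m => adic_val G (maxn n k)) aF).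
have [|y yk /(mulfI a0) xy] := nP x.
  apply: (@ideal_pow_le _ _ n (maxn n k).+1); first by rewrite leqW // leq_maxl.
  by rewrite -adic_pi_eq0 aFn.
rewrite (@adic_coherentE _ _ F k (maxn n k)) ?leq_maxr // -/x xy.
by apply/eqP; rewrite adic_pi_eq0.
Qed.

(** * Completions of domains of smaller cardinality *)

Lemma card_lt_intro (X Y : Type) : embeds X Y -> ~ embeds Y X -> card_lt X Y.
Proof.
move=> /card_le_embeds XY nYX; split=> //; apply/negP.
by move/card_eqPle=> [_ /card_le_embeds].
Qed.

Lemma card_lt_elim (X Y : Type) : card_lt X Y -> embeds X Y /\ ~ embeds Y X.
Proof.
move=> [XY /negP nXY]; split; first exact/card_le_embeds.
move=> /card_le_embeds YX; apply: nXY; exact/card_eqPle.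
Qed.

Section Necessity.
Variables (T : comNzRingType) (M : idealr T) (A : idomainType) (m : idealr A).
Hypotheses (locT : local_ring M) (locA : local_ring m).
Variable f : {rmorphism adic_completion m -> T}.
Hypotheses (f_bij : bijective f) (card_A : card_lt A T).

Let noethA : noetherian A. Proof. by case: locA. Qed.

Definition dense_map (a : A) : T := f (to_completion m a).

Lemma dense_map_regular a t : a != 0 -> dense_map a * t = 0 -> t = 0.
Proof.
case: f_bij => g _ gK; rewrite -[t]gK -rmorphM => a0 /eqP.
rewrite -(rmorph0 f) (inj_eq (bij_inj f_bij)) => /eqP.
by move=> /(completion_regular noethA a0) ->.
Qed.

(** The elements of the completion with zero first component form a proper
ideal, and every proper ideal lies in [M]. *)
Lemma residue_zero F : adic_val F 0 = 0 -> f F \in M.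
Proof.
move=> F0; apply: contraT => /(local_unit locT)[y].
case: f_bij => g _ gK; rewrite -[y]gK -rmorphM -(rmorph1 f).
move=> /(bij_inj f_bij) /(congr1 (fun G => adic_val G 0)).
rewrite -[adic_val (F * g y) 0]/(adic_val F 0 * adic_val (g y) 0) F0 mul0r.
by move/esym/eqP; rewrite -[adic_val 1 0]/(1 : adic_quot m 0) oner_eq0.
Qed.

Lemma dense_map_in a : a \in m -> dense_map a \in M.
Proof.
by move=> am; apply: residue_zero; apply/eqP; rewrite adic_pi_eq0 ideal_pow1.
Qed.

Lemma dense_map_int (z : int) : dense_map z%:~R = z%:~R.
Proof. by rewrite /dense_map !rmorph_int. Qed.

Lemma residue_dense t : exists a, t - dense_map a \in M.
Proof.
case: f_bij => g _ gK; exists (repr (adic_val (g t) 0)).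
rewrite -[t in t - _]gK -rmorphB; apply: residue_zero.
rewrite -[adic_val _ 0]/(adic_val (g t) 0 - adic_pi m 0 _) adic_piK.
by rewrite subrr.
Qed.

(** If [m = 0], an element of the completion is determined by its first
component, so [T] embeds into [A], against [card_lt A T]. *)
Lemma maximal_nonzero : exists2 a, a \in m & a != 0.
Proof.
have [_ nTA] := card_lt_elim card_A.
have [//|m0] := pselect (exists2 a, a \in m & a != 0).
have {}m0 a : a \in m -> a = 0.
  by move=> am; apply/eqP; apply: contraT => a0; case: m0; exists a.
case: nTA; case: f_bij => g _ gK.
exists (fun t => repr (adic_val (g t) 0)) => t u e.
rewrite -[t]gK -[u]gK; congr (f _); apply: completionP.
suff rep n : repr (adic_val (g t) n) = repr (adic_val (g u) n).
  by move=> n; rewrite -[LHS]adic_piK rep adic_piK.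
have e0 : adic_val (g t) 0 = adic_val (g u) 0 by rewrite -[LHS]adic_piK e adic_piK.
apply/eqP; rewrite -subr_eq0; apply/eqP/m0; rewrite -ideal_pow1.
apply/(@adic_pi_eqP _ m 0).
by rewrite -!adic_coherentE.
Qed.

Lemma necessity : [/\ forall z : int, (z%:~R : T) != 0 -> ~ zerodivisor (z%:~R : T),
  ~ Ass T M & card_lt {ideal_quot M} T].
Proof.
have [[iota iota_inj] nTA] := card_lt_elim card_A.
split.
- move=> z z0 [y y0 zy]; case/eqP: y0.
  apply: (@dense_map_regular z%:~R); last by rewrite dense_map_int.
  by apply: contraNneq z0 => e; rewrite -dense_map_int e /dense_map !rmorph0.
- move=> [_ _ [x Mx]].
  have [a am a0] := maximal_nonzero.
  have := dense_map_in am; rewrite Mx => /eqP /(dense_map_regular a0) x0.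
  by have := idealr1 M; rewrite Mx inE x0 mulr0 eqxx.
have [s sinj] : embeds {ideal_quot M} A.
  have /choice[s sP] : forall q : {ideal_quot M}, exists a, repr q - dense_map a \in M.
    by move=> q; apply: residue_dense.
  exists s => q r e; rewrite -[q]reprK -[r]reprK; apply/eqP.
  rewrite -Quotient.idealrBE.
  have -> : repr q - repr r = (repr q - dense_map (s q)) - (repr r - dense_map (s r)).
    by rewrite e opprB addrA subrK.
  by rewrite rpredB.
apply: card_lt_intro; first by exists (iota \o s); apply: inj_comp.
by move=> h; apply: nTA; apply: embeds_trans h _; exists s.
Qed.

End Necessity.

(** * Zero divisors of a Noetherian ring *)

Section ZeroDivisors.
Variable R : comNzRingType.
Implicit Types (t u v x y z : R) (s : seq R).

Definition regular t : Prop := forall y, t * y = 0 -> y = 0.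

Lemma regular1 : regular 1.
Proof. by move=> y; rewrite mul1r. Qed.

Lemma regularM t u : regular t -> regular u -> regular (t * u).
Proof. by move=> rt ru y; rewrite -mulrA => /rt /ru. Qed.

Lemma regularX t n : regular t -> regular (t ^+ n).
Proof.
by move=> rt; elim: n => [|n IHn]; [exact: regular1 | rewrite exprS; apply: regularM].
Qed.

Lemma regular_factor t u : regular (t * u) -> regular u.
Proof. by move=> rtu y uy; apply: rtu; rewrite -mulrA uy mulr0. Qed.

Lemma unit_regular t u : t * u = 1 -> regular t.
Proof. by move=> tu y ty; rewrite -[y]mul1r -tu mulrAC ty mul0r. Qed.

Definition ann x : set R := [set t | t * x = 0].

Lemma ann_is_ideal x : is_ideal (ann x).
Proof.
rewrite /ann; split=> [|t u /= tx ux|a t /= tx] /=; first by rewrite mul0r.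
  by rewrite mulrDl tx ux addr0.
by rewrite -mulrA tx mulr0.
Qed.

(** The annihilator of [x] is maximal among annihilators of nonzero elements.
These annihilators are prime, and each zero divisor lies in one of them. *)
Definition maximal_ann x : Prop :=
  x != 0 /\ forall y, y != 0 -> ann x `<=` ann y -> ann y `<=` ann x.

Lemma maximal_ann_prime x u v :
  maximal_ann x -> u * v * x = 0 -> u * x = 0 \/ v * x = 0.
Proof.
move=> [x0 xmax] uvx; have [vx|vx] := eqVneq (v * x) 0; first by right.
left; have sub : ann x `<=` ann (v * x).
  by move=> t tx; rewrite /ann /= mulrCA tx mulr0.
by have := xmax _ vx sub u; rewrite /ann /= mulrA; apply.
Qed.

(** Multiplying an element of [P] outside the prime [ann x] by elements of the
other annihilators outside [ann x] stays outside [ann x]. *)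
Lemma maximal_ann_avoid (P : R -> Prop) x s : maximal_ann x ->
  (forall a b, P a -> P (b * a)) -> (exists2 a, P a & a * x != 0) ->
  (forall y, y \in s -> ~ ann y `<=` ann x) ->
  exists u, [/\ P u, u * x != 0 & forall y, y \in s -> u * y = 0].
Proof.
move=> xmax PM [a Pa ax]; elim: s => [|y s IHs] sx; first by exists a.
have [|u [Pu ux us]] := IHs; first by move=> z zs; apply: sx; rewrite inE zs orbT.
have /existsNP[v /not_implyP[vy vx]] := sx y (mem_head _ _).
exists (v * u); split; first exact: PM.
  apply/eqP => /(maximal_ann_prime xmax)[//|]; exact/eqP.
move=> z; rewrite inE => /orP[/eqP ->|/us uz]; first by rewrite mulrAC vy mul0r.
by rewrite -mulrA uz mulr0.
Qed.

Hypothesis noethR : noetherian R.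

Lemma zerodivisor_maximal_ann t : ~ regular t ->
  exists2 x, maximal_ann x & t * x = 0.
Proof.
move=> /existsNP[y /not_implyP[ty y0]].
pose P (J : set R) := exists2 x, x != 0 & J = ann x /\ ann y `<=` ann x.
have [||_ [x x0 [-> yx]] xmax] := @noetherian_max R P (ann y) noethR.
- by exists y; [apply/eqP | split].
- by move=> _ [x _ [-> _]]; apply: ann_is_ideal.
exists x; last exact: yx.
split=> // z z0 xz; apply: xmax => //.
by exists z => //; split=> // u /yx /xz.
Qed.

(** Let [s] generate the ideal spanned by all [x] with maximal annihilator.
If no [ann y], with [y] in [s], were contained in [ann x], a product of elements
taken from them outside [ann x] would kill [s], hence [x]: a contradiction.
So the annihilators of the elements of [s] are all the maximal ones. *)
Lemma zerodivisor_finite : exists s, (forall x, x \in s -> maximal_ann x) /\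
  forall t, ~ regular t -> exists2 x, x \in s & t * x = 0.
Proof.
have [s sX Xs] := noetherian_span maximal_ann noethR.
exists s; split=> // t /zerodivisor_maximal_ann[x xmax tx].
have [[y ys yx]|nx] := pselect (exists2 y, y \in s & ann y `<=` ann x).
  by exists y => //; exact: ((sX y ys).2 x xmax.1 yx t tx).
have [|||u [_ ux us]] := @maximal_ann_avoid (fun=> True) x s xmax.
- by [].
- by exists 1; [|rewrite mul1r; case: xmax].
- by move=> y ys yx; apply: nx; exists y.
case/eqP: ux; rewrite mulrC.
apply: (lin_min (ann_is_ideal u) _ (Xs _ (span_sub xmax))) => y /us.
by rewrite /ann /= mulrC.
Qed.

(** Suppose that [z] avoids the annihilators treated so far but lies in the next
one, [ann x].  None of the former is contained in [ann x], for it would be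
equal to it; so some [u] in [M] lies in all of them and outside [ann x], and
[z + u] avoids everything. *)
Lemma prime_avoidance (M : idealr R) s :
  (forall x, x \in s -> maximal_ann x) ->
  (forall x, x \in s -> exists2 a, a \in M & a * x != 0) ->
  exists2 z, z \in M & forall x, x \in s -> z * x != 0.
Proof.
elim: s => [|x s IHs] smax sM; first by exists 0; [exact: rpred0|].
have [||z zM zs] := IHs.
- by move=> y ys; apply: smax; rewrite inE ys orbT.
- by move=> y ys; apply: sM; rewrite inE ys orbT.
have xmax := smax x (mem_head _ _).
have [zx|zx] := eqVneq (z * x) 0; last first.
  by exists z => // y; rewrite inE => /orP[/eqP ->|/zs].
have [|||u [uM ux us]] := @maximal_ann_avoid (fun u => u \in M) x s xmax.
- by move=> a b; apply: idealMr.
- exact: sM (mem_head _ _).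
- move=> y ys yx; have /(_ _ zx) : ann x `<=` ann y.
    by apply: (smax y _).2 => //; [rewrite inE ys orbT | case: xmax].
  by apply/eqP; apply: zs.
exists (z + u); first exact: rpredD.
move=> y; rewrite inE => /orP[/eqP ->|ys]; first by rewrite mulrDl zx add0r.
by rewrite mulrDl us // addr0 zs.
Qed.

(** A maximal annihilator that contained [M] would be equal to it, and [M] would
be associated. *)
Lemma regular_in_maximal (M : idealr R) : maximal_ideal M -> ~ Ass R M ->
  exists2 z, z \in M & regular z.
Proof.
move=> Mmax nAss; have [s [smax sP]] := zerodivisor_finite.
have [|z zM zs] := @prime_avoidance M s smax.
  move=> x xs; have [//|nx] := pselect (exists2 a, a \in M & a * x != 0).
  have x1 : ~ ann x 1 by rewrite /ann /= mul1r; apply/eqP; case: (smax x xs).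
  have Mx : ideal_pred (ann_is_ideal x) x1 =i M.
    apply: Mmax => a aM; apply/asboolP; apply/eqP; apply: contraT => ax.
    by case: nx; exists a.
  case: nAss; split.
  - split; [exact: rpred0 | by rewrite idealr1 |].
    by move=> a u v uM vM; rewrite rpredD ?idealMr.
  - move=> u v; rewrite -!Mx => /asboolP /(maximal_ann_prime (smax x xs)).
    by case=> h; apply/orP; [left | right]; apply/asboolP.
  - by exists x => a; rewrite -Mx; apply/asboolP/eqP.
exists z => //; have [//|/sP[x xs zx]] := pselect (regular z).
by have := zs x xs; rewrite zx eqxx.
Qed.

End ZeroDivisors.

(** * Complete local rings *)

(** The diagonal set of those [f c] with [c (f c) = false]. *)
Lemma cantor_nat : ~ embeds (nat -> bool) nat.
Proof.
move=> [f fi]; pose S n := `[< exists c, f c = n /\ c n = false >].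
have [/asboolP[c [/fi cS cf]]|nS] := boolP (S (f S)).
  have : S (f S) = false by rewrite -{1}cS.
  by move/asboolPn; apply; exists S; split; rewrite // -{1}cS.
by move/asboolPn: (nS); apply; exists S; split=> //; apply/negbTE.
Qed.

(** If [X] is infinite, [X + nat] embeds into [X], and the sequences in [X] would
embed into [X], hence so would [T].  If [X] is finite, [X + nat] is countable,
whereas there are uncountably many sequences. *)
Lemma sequences_not_embedded (X T : Type) : card_lt X T -> embeds bool X ->
  embeds T (nat -> X) -> ~ embeds (nat -> X) (X + nat)%type.
Proof.
move=> /card_lt_elim[_ nTX] [b bi] Tseq seqX.
have [NX|] := pselect (embeds nat X).
  apply: nTX; apply: embeds_trans Tseq _; apply: embeds_trans seqX _.
  apply: embeds_trans (embeds_square NX).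
  case: NX => e ei.
  exists (fun u => match u with inl x => (b true, x) | inr n => (b false, e n) end).
  by move=> [x|m] [y|n] [] => [->|/bi//|/bi//|/ei ->].
move=> nNX; have Xfin : finite_set [set: X].
  apply: contrapT => /infiniteP Ninf; apply: nNX; exact/card_le_embeds.
have [c ci] : embeds X nat.
  by apply/card_le_embeds; apply: finite_set_countable.
apply: cantor_nat; apply: (@embeds_trans _ (nat -> X)).
  exists (fun u n => b (u n)) => u v e; apply: functional_extensionality_dep => n.
  by apply: bi; apply: (congr1 (fun w => w n) e).
apply: embeds_trans seqX _.
exists (fun u => match u with inl x => (c x).*2 | inr n => n.*2.+1 end).
move=> [x|m] [y|n] e.
- by congr inl; apply: ci; apply: double_inj.
- by move/(congr1 odd): e; rewrite /= !odd_double.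
- by move/(congr1 odd): e; rewrite /= !odd_double.
- by congr inr; case: e => /double_inj.
Qed.

Section CompleteLocal.
Variables (T : comNzRingType) (M : idealr T).
Hypotheses (locT : local_ring M) (complT : adic_complete M).

Lemma adic_separated x : (forall n, x \in ideal_pow M n) -> x = 0.
Proof.
move=> xM; apply: (bij_inj complT); apply: completionP => n.
by rewrite rmorph0; apply/eqP; rewrite adic_pi_eq0.
Qed.

(** Surjectivity of the map to the completion, in terms of sequences. *)
Lemma adic_limit (s : nat -> T) :
  (forall n, s n.+1 - s n \in ideal_pow M n.+1) ->
  exists t, forall n, t - s n \in ideal_pow M n.+1.
Proof.
move=> sM; pose F : prod_ring (adic_quot M) := fun n => adic_pi M n (s n).
have cF : F \in adic_coherent (I := M).
  apply/adic_coherentP => n; rewrite /F adic_transE; exact/adic_pi_eqP.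
case: complT => g _ gK; exists (g (AdicCompletion cF)) => n.
apply/adic_pi_eqP.
exact: (congr1 (fun G : adic_completion M => adic_val G n) (gK (AdicCompletion cF))).
Qed.

(** [psi c] is the sum of the series of the [c i * z ^+ i].  Only the recursion
obtained by splitting off the constant term is used later. *)
Lemma power_series_exists z : z \in M -> exists psi : (nat -> T) -> T,
  forall c, psi c = c 0%N + z * psi (c \o succn).
Proof.
move=> zM; pose S (c : nat -> T) n := \sum_(i < n.+1) c i * z ^+ i.
have zn n : z ^+ n \in ideal_pow M n.
  elim: n => [|n IHn]; first exact: ideal_pow0.
  by rewrite exprS ideal_powS.
have /choice[psi psiP] : forall c, exists t, forall n, t - S c n \in ideal_pow M n.+1.
  move=> c; apply: adic_limit => n.
  by rewrite /S [X in X - _]big_ord_recr /= addrAC subrr add0r idealMr.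
exists psi => c; apply/eqP; rewrite -subr_eq0; apply/eqP/adic_separated => n.
apply: ideal_pow_decr.
have -> : psi c - (c 0%N + z * psi (c \o succn)) =
    psi c - S c n.+1 - z * (psi (c \o succn) - S (c \o succn) n).
  have -> : S c n.+1 = c 0%N + z * S (c \o succn) n.
    rewrite /S big_ord_recl expr0 mulr1 mulr_sumr; congr (_ + _).
    by apply: eq_bigr => i _; rewrite exprS mulrCA.
  by rewrite mulrBr opprB !opprD !addrA addrNK.
rewrite rpredB //; first by apply: ideal_pow_decr; apply: psiP.
by rewrite idealMr.
Qed.

Lemma residue_neq (q r : {ideal_quot M}) : q != r -> repr q - repr r \notin M.
Proof. by rewrite Quotient.idealrBE !reprK. Qed.

(** If [c] and [d] first differ at [j], the difference of the two series is
[z ^+ j] times a series whose constant term is a difference of two distinct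
residues, thus a unit. *)
Lemma regular_differences z : z \in M -> regular z ->
  exists psi : (nat -> {ideal_quot M}) -> T,
    forall c d, c <> d -> regular (psi c - psi d).
Proof.
move=> zM zreg; have [psi psiE] := power_series_exists zM.
exists (fun c => psi (repr \o c)) => c d cd.
have [j cj jmin] : exists2 j, c j != d j & forall i, (i < j)%N -> c i = d i.
  have ex : exists j, c j != d j.
    apply: contrapT => h; apply: cd; apply: functional_extensionality_dep => j.
    by apply/eqP; apply: contraT => cj; case: h; exists j.
  have [j cj jmin] := ex_minnP ex; exists j => // i; rewrite ltnNge => ij.
  by apply/eqP; apply: contraNT ij; apply: jmin.
elim: j c d {cd} cj jmin => [|j IHj] c d cj jmin.
  have [|y uy] := @local_unit _ _ locT (psi (repr \o c) - psi (repr \o d)).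
    rewrite psiE [psi (repr \o d)]psiE /= opprD addrACA -mulrBr.
    rewrite rpredDr; first exact: residue_neq.
    by rewrite mulrC idealMr.
  exact: unit_regular uy.
rewrite psiE [psi (repr \o d)]psiE /= opprD addrACA -mulrBr jmin // subrr add0r.
by apply: regularM => //; apply: (IHj (c \o succn) (d \o succn)) => // i ij; apply: jmin.
Qed.

(** Expanding [t] as a residue plus a combination of generators of [M], and the
coefficients again in the same way, labels every finite word in the generators
with a residue.  The labels of the words shorter than [n] determine [t]
modulo [M^n]. *)
Lemma embeds_residue_sequences : embeds T (nat -> {ideal_quot M}).
Proof.
have [noethT _ _] := locT.
have [g gM Mg] := noetherian_span [set x | x \in M] noethT.
pose pi (t : T) : {ideal_quot M} := \pi_{ideal_quot M} t.
have piK t : t - repr (pi t) \in M by rewrite Quotient.idealrBE reprK.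
have /choice[step stepP] : forall t, exists c : 'I_(size g) -> T,
    t - repr (pi t) = \sum_(i < size g) c i * g`_i.
  by move=> t; apply/lin_sumP/Mg/span_sub; apply: piK.
(* [code t w] is the residue of the coefficient of [t] reached along [w]. *)
pose code t (w : seq 'I_(size g)) := pi (foldl step t w).
have codeI n : forall t u, (forall w, (size w < n)%N -> code t w = code u w) ->
    t - u \in ideal_pow M n.
  elim: n => [|n IHn] t u tu; first exact: ideal_pow0.
  have e0 : pi t = pi u := tu [::] isT.
  have -> : t - u = (t - repr (pi t)) - (u - repr (pi u)).
    by rewrite e0 opprB addrA subrK.
  rewrite !stepP -sumrB rpred_sum // => i _; rewrite -mulrBl mulrC ideal_powS //.
    by apply: gM; apply: mem_nth.
  by apply: IHn => w sw; apply: (tu (i :: w)).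
exists (fun t n => if unpickle n is Some w then code t w else 0) => t u tu.
apply/eqP; rewrite -subr_eq0; apply/eqP/adic_separated => n; apply: codeI => w _.
by have := congr1 (fun c => c (pickle w)) tu; cbv beta; rewrite pickleK.
Qed.

End CompleteLocal.

(** * Adjoining elements to a small subring *)

Section Subrings.
Variable T : comNzRingType.
Implicit Types (B : set T) (x : T) (p q : {poly T}).

Record is_subring B : Prop := IsSubring {
  is_subring1 : B 1;
  is_subringB : forall x y, B x -> B y -> B (x - y);
  is_subringM : forall x y, B x -> B y -> B (x * y) }.

(** Gives a set that is a subring the canonical closure properties needed for
polynomials over it and, later, for its ring structure. *)
Definition subring_pred B (BB : is_subring B) : {pred T} := [pred x | `[< B x >]].

Lemma subring_pred_closed B (BB : is_subring B) : subring_closed (subring_pred BB).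
Proof.
case: (BB) => B1 BS BM; split; first exact/asboolP.
  by move=> x y /asboolP Bx /asboolP By; apply/asboolP/BS.
by move=> x y /asboolP Bx /asboolP By; apply/asboolP/BM.
Qed.

HB.instance Definition _ B BB :=
  GRing.isSubringClosed.Build T (@subring_pred B BB) (subring_pred_closed BB).

Definition coef_in B p : Prop := forall i, B p`_i.

Lemma coef_inP B (BB : is_subring B) p :
  coef_in B p <-> p \is a polyOver (subring_pred BB).
Proof.
by split=> [Bp|/polyOverP Bp i]; [apply/polyOverP => i|]; apply/asboolP; apply: Bp.
Qed.

(** The ring [B[x]]. *)
Definition adjoin B x : set T := [set p.[x] | p in coef_in B].

Lemma adjoin_subring B x : is_subring B -> is_subring (adjoin B x).
Proof.
move=> BB; split.
- exists 1; last by rewrite hornerC.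
  by apply/(coef_inP BB); apply: rpred1.
- move=> _ _ [p /(coef_inP BB) Bp <-] [q /(coef_inP BB) Bq <-]; exists (p - q).
    by apply/(coef_inP BB); apply: rpredB.
  by rewrite hornerD hornerN.
- move=> _ _ [p /(coef_inP BB) Bp <-] [q /(coef_inP BB) Bq <-]; exists (p * q).
    by apply/(coef_inP BB); apply: rpredM.
  by rewrite hornerM.
Qed.

Lemma adjoin_base B x : is_subring B -> B `<=` adjoin B x.
Proof.
move=> BB b Bb; exists b%:P; last by rewrite hornerC.
by apply/(coef_inP BB); rewrite polyOverC; apply/asboolP.
Qed.

Lemma adjoin_gen B x : is_subring B -> adjoin B x x.
Proof.
by move=> BB; exists 'X; [apply/(coef_inP BB); apply: polyOverX | rewrite hornerX].
Qed.

End Subrings.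

Section Good.
Variables (T : comNzRingType) (K : Type).
Hypotheses (KN : embeds nat K) (KK : embeds (K * K) K).
Implicit Types (B : set T) (x t a : T) (p q : {poly T}).

(** [good_regular] says that [B] meets every associated prime in [0] only. *)
Record good B : Prop := Good {
  good_subring : is_subring B;
  good_regular : forall x, B x -> x != 0 -> regular x;
  good_small : small K B }.

Lemma small_polys B : small K B -> small K [set p : {poly T} | coef_in B p].
Proof.
move=> sB; apply: (@small_sub _ _ _
    ((@Poly T) @` [set s : seq T | forall x, x \in s -> B x])).
  move=> p Bp; exists p; last exact: polyseqK.
  by move=> x /(nthP 0)[i _ <-].
by apply: small_image => //; apply: small_seq.
Qed.

Lemma good_adjoin B x : good B ->
  (forall p, coef_in B p -> p.[x] != 0 -> regular p.[x]) -> good (adjoin B x).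
Proof.
move=> [BB Breg sB] pxreg; split; first exact: adjoin_subring.
  by move=> _ [p Bp <-]; apply: pxreg.
by apply: small_image => //; apply: small_polys.
Qed.

(** Multiplying a value [p.[t]] by [a ^+ size p] clears the denominators, and
gives an element of [B]; a factor of a regular element is regular. *)
Lemma good_quotient B a t : good B -> B a -> a != 0 -> B (a * t) ->
  good (adjoin B t).
Proof.
move=> gB Ba a0 Bat; apply: good_adjoin => // p Bp pt0.
case: (gB) => BB Breg _; have rega := Breg a Ba a0.
apply: (@regular_factor _ (a ^+ size p)); apply: Breg; last first.
  by apply: contraNneq pt0 => /(@regularX _ a (size p) rega) ->.
have -> : a ^+ size p * p.[t] =
    \sum_(i < size p) p`_i * (a ^+ (size p - i) * (a * t) ^+ i).
  rewrite horner_coef mulr_sumr; apply: eq_bigr => i _.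
  have -> : a ^+ size p = a ^+ (size p - i) * a ^+ i by rewrite -exprD subnK // ltnW.
  by rewrite exprMn mulrCA !mulrA.
have inB x : x \in subring_pred BB <-> B x by split=> /asboolP.
apply/inB/rpred_sum => i _; apply: rpredM; first exact/inB.
by apply: rpredM; apply: rpredX; apply/inB.
Qed.

(** Induction on the degree, dividing by ['X - phi c0] for a root [c0].  The prime
[ann x] stands for the domain over which roots are counted, and the leading
coefficient is kept outside of it. *)
Lemma roots_small (X : Type) (phi : X -> T) x n : maximal_ann x ->
  (forall c d, c <> d -> (phi c - phi d) * x != 0) ->
  forall p, size p = n -> lead_coef p * x != 0 ->
  small K [set c | p.[phi c] * x = 0].
Proof.
move=> xmax phi_inj; elim: n => [|n IHn] p sp lpx.
  have p0 : p = 0 by apply/eqP; rewrite -size_poly_eq0 sp.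
  by move: lpx; rewrite p0 lead_coef0 mul0r eqxx.
set Z := (X in small K X).
have [[c0 Zc0]|Z0] := pselect (exists c, Z c); last first.
  by case: KN => k _; exists (fun=> k 0%N) => c d Zc; case: Z0; exists c.
have n0 : (0 < n)%N.
  rewrite lt0n; apply: contra_neqN lpx => /eqP n0; rewrite n0 in sp.
  have /size_poly1P[c _ pc] : size p == 1%N by rewrite sp.
  by move: Zc0; rewrite /Z /= pc hornerC lead_coefC => ->.
have sC : (size (- p.[phi c0]%:P)%R < size p)%N.
  by rewrite sp size_polyN (leq_ltn_trans (size_polyC_leq1 _)).
have /factor_theorem[q pq] : root (p - p.[phi c0]%:P) (phi c0).
  by rewrite rootE hornerD hornerN hornerC subrr.
have lq : lead_coef q = lead_coef p.
  by rewrite -(lead_coefDl sC) pq lead_coef_Mmonic ?monicXsubC.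
have q0 : q != 0.
  by apply: contraNneq lpx => q0; rewrite -lq q0 lead_coef0 mul0r.
have sq : size q = n.
  have := size_Mmonic q0 (monicXsubC (phi c0)).
  by rewrite -pq (size_polyDl sC) sp size_XsubC addn2 => -[].
apply: (@small_sub _ _ _ ([set c0] `|` [set c | q.[phi c] * x = 0])).
  move=> c Zc; have [->|cc0] := pselect (c = c0); [by left | right].
  have : (p - p.[phi c0]%:P).[phi c] * x = 0.
    by rewrite hornerD hornerN hornerC mulrBl Zc Zc0 subrr.
  rewrite pq hornerM hornerXsubC => /(maximal_ann_prime xmax)[] //.
  by have /eqP := phi_inj _ _ cc0.
rewrite -bigcup2E; apply: small_bigcup => // [|[|[|i]] _] /=.
- exact: small_countable.
- by case: KN => k _; exists (fun=> k 0%N) => c d -> ->.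
- by apply: IHn; rewrite // lq.
- by case: KN => k _; exists (fun=> k 0%N).
Qed.

Hypothesis noethT : noetherian T.

(** For each nonzero [p] over [B] and each of the finitely many annihilators that
cover the zero divisors, the excluded points form a small set.  There are few
such polynomials, so the excluded points do not exhaust [X]. *)
Lemma generic_exists (X : Type) (phi : X -> T) B t a : ~ embeds X K ->
  (forall c d, c <> d -> regular (phi c - phi d)) -> good B -> regular a ->
  exists c, forall p, coef_in B p -> p != 0 -> regular p.[t + a * phi c].
Proof.
move=> nXK phi_reg gB rega; apply: contrapT => nc; apply: nXK; apply/small_embeds.
have [s [smax sP]] := zerodivisor_finite noethT.
pose bad p x := [set c | p.[t + a * phi c] * x = 0].
apply: (@small_sub _ _ _ (\bigcup_(p in [set p | coef_in B p /\ p != 0])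
    \bigcup_(x in [set x | x \in s]) bad p x)).
  move=> c _; have /existsNP[p] : ~ forall p, coef_in B p -> p != 0 ->
      regular p.[t + a * phi c] by move=> h; apply: nc; exists c.
  move=> /not_implyP[Bp /not_implyP[p0 /sP[x xs px]]].
  by exists p => //; exists x.
apply: small_bigcup => // [|p [Bp p0]].
  by apply: small_sub (small_polys (good_small gB)) => p [].
apply: small_bigcup => // [|x xs].
  case: KN => k ki; exists (fun x => k (index x s)) => x y xs ys /ki.
  by move/(congr1 (nth 0 s)); rewrite !nth_index.
apply: (roots_small (phi := fun c => t + a * phi c)) (erefl (size p)) _.
- exact: smax.
- move=> c d /phi_reg r; rewrite opprD addrACA subrr add0r -mulrBr.
  by apply/eqP => /(regularM rega r); apply/eqP; case: (smax x xs).
- apply/eqP => /(good_regular gB (Bp _)) h; have := (smax x xs).1.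
  by rewrite h ?eqxx ?lead_coef_eq0.
Qed.

End Good.

(** * Closing a small subring under linear systems *)

Section Closure.
Variables (T : comNzRingType) (K : Type).
Hypotheses (KN : embeds nat K) (KK : embeds (K * K) K).
Local Notation good := (@good T K).
Implicit Types (B : set T) (x t a : T).

Lemma lin0 B s : B 0 -> lin B s 0.
Proof.
move=> B0; elim: s => //= a s IHs; exists 0, 0; split=> //.
by rewrite mul0r addr0.
Qed.

Lemma subring0 B : is_subring B -> B 0.
Proof. by case=> B1 BS _; rewrite -(subrr 1); apply: BS. Qed.

(** The chain must be indexed by a small set for its union to be small. *)
Lemma good_bigcup (J : Type) (D : set J) (F : J -> set T) : D !=set0 -> small K D ->
  (forall i j, D i -> D j -> F i `<=` F j \/ F j `<=` F i) ->
  (forall i, D i -> good (F i)) -> good (\bigcup_(i in D) F i).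
Proof.
move=> [i0 Di0] sD chain gF.
have both x y : (\bigcup_(i in D) F i) x -> (\bigcup_(i in D) F i) y ->
    exists2 i, D i & F i x /\ F i y.
  move=> [i Di Fx] [j Dj Fy]; have [ij|ji] := chain i j Di Dj.
    by exists j => //; split=> //; apply: ij.
  by exists i => //; split=> //; apply: ji.
split; first split.
- by exists i0 => //; case: (gF _ Di0) => -[].
- move=> x y Ux Uy; have [i Di [Fx Fy]] := both x y Ux Uy.
  by exists i => //; case: (gF _ Di) => -[_ FS _ _ _]; apply: FS.
- move=> x y Ux Uy; have [i Di [Fx Fy]] := both x y Ux Uy.
  by exists i => //; case: (gF _ Di) => -[_ _ FM _ _]; apply: FM.
- by move=> x [i Di Fx]; case: (gF _ Di) => _ Freg _; apply: Freg.
- by apply: small_bigcup => // i Di; case: (gF _ Di).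
Qed.

(** A partial execution of the tasks: those in [E] have been carried out in [B]. *)
Record stage (J : Type) (B0 : set T) (D : set J) (Q : J -> set T -> Prop)
    (E : set J) (B : set T) : Prop := Stage {
  stage_sub : E `<=` D;
  stage_good : good B;
  stage_base : B0 `<=` B;
  stage_done : forall j, E j -> Q j B }.

(** Stages are ordered by strict progress in the set of finished tasks.  In a
chain without a last element, choosing for each finished task a stage where it
is finished gives a cofinal family.  It is indexed by tasks, hence small, so
the union of the chain is a good subring although the chain may be long.  A
maximal stage has no task left. *)
Lemma good_tasks (J : Type) (D : set J) (Q : J -> set T -> Prop) B0 :
  small K D -> good B0 ->
  (forall j B B', B `<=` B' -> Q j B -> Q j B') ->
  (forall j B, D j -> good B -> B0 `<=` B ->
     exists B', [/\ good B', B `<=` B' & Q j B']) ->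
  exists B, [/\ good B, B0 `<=` B & forall j, D j -> Q j B].
Proof.
move=> sD gB0 Qmono Qstep.
pose S := {EB : set J * set T | stage B0 D Q EB.1 EB.2}.
pose lt (p q : S) := [/\ (sval p).1 `<=` (sval q).1, ~ (sval q).1 `<=` (sval p).1
  & (sval p).2 `<=` (sval q).2].
pose r (p q : S) := `[< p = q \/ lt p q >].
have st0 : stage B0 D Q set0 B0 by split.
have [||| t tmax] := @ZL_preorder S (exist _ (set0, B0) st0) r.
- by move=> p; apply/asboolP; left.
- move=> p q u /asboolP[<-|[pq nqp pq2]] /asboolP[<-|[qu nuq qu2]]; apply/asboolP.
  + by left.
  + by right; split.
  + by right; split.
  + right; split; [exact: subset_trans qu | | exact: subset_trans qu2].
    by move=> up; apply: nqp; apply: subset_trans up.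
- move=> C Ctot.
  have [[p Cp pmax]|nmax] := pselect (exists2 p, C p & forall q, C q -> r q p).
    by exists p.
  have next p : C p -> exists2 q, C q & lt p q.
    move=> Cp; have /existsNP[q /not_implyP[Cq nqp]] : ~ forall q, C q -> r q p.
      by move=> h; apply: nmax; exists p.
    exists q => //; case: (Ctot _ _ Cp Cq) => [/asboolP[e|//]|//].
    by case: nqp; apply/asboolP; left.
  have [[p0 Cp0]|C0] := pselect (exists p, C p); last first.
    by exists (exist _ (set0, B0) st0) => p Cp; case: C0; exists p.
  pose E := \bigcup_(p in C) (sval p).1; pose U := \bigcup_(p in C) (sval p).2.
  have /choice[at_ atP] : forall j, exists p, E j -> C p /\ (sval p).1 j.
    move=> j; have [[p Cp pj]|nE] := pselect (E j); first by exists p.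
    by exists p0.
  have above p : C p -> exists j, E j /\ (sval p).2 `<=` (sval (at_ j)).2.
    move=> Cp; have [q Cq [_ nqp _]] := next p Cp.
    have /existsNP[j /not_implyP[qj npj]] := nqp.
    have Ej : E j by exists q.
    have [Ca aj] := atP j Ej; exists j; split=> //.
    case: (Ctot _ _ Cp Ca) => /asboolP[|[]] //.
      by move=> <-.
    + by move=> e; case: npj; rewrite -e.
    + by move=> sub _ _; case: npj; apply: sub.
  (* The stages [at_ j] are cofinal, and [E] is small while [C] need not be. *)
  have UE : U = \bigcup_(j in E) (sval (at_ j)).2.
    apply/seteqP; split=> x.
      move=> [p Cp px]; have [j [Ej pj]] := above p Cp.
      by exists j => //; apply: pj.
    by move=> [j Ej ajx]; exists (at_ j) => //; case: (atP j Ej).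
  have ED : E `<=` D by move=> j [p _ pj]; case: (svalP p) => pD _ _ _; apply: pD.
  have stU : stage B0 D Q E U.
    split=> //.
    - rewrite UE; apply: good_bigcup.
      + by have [j [Ej _]] := above p0 Cp0; exists j.
      + exact: small_sub sD.
      + move=> i j /atP[Ci _] /atP[Cj _].
        by case: (Ctot _ _ Ci Cj) => /asboolP[->|[_ _ ?]]; [left|left|left|right].
      + by move=> j _; case: (svalP (at_ j)).
    - by move=> x B0x; exists p0 => //; case: (svalP p0) => _ _ b _; apply: b.
    - move=> j [p Cp pj]; apply: (Qmono j (sval p).2); first by move=> x px; exists p.
      by case: (svalP p) => _ _ _; apply.
  exists (exist _ (E, U) stU) => p Cp; apply/asboolP; right; split=> /=.
  + by move=> j pj; exists p.
  + have [q Cq [_ nqp _]] := next p Cp.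
    by move=> Ep; apply: nqp => j qj; apply: Ep; exists q.
  + by move=> x px; exists p.
case: t tmax => -[E B] /= [ED gB B0B EQ] tmax.
exists B; split=> // j Dj; have [/EQ //|nEj] := pselect (E j).
have [B' [gB' BB' QB']] := Qstep j B Dj gB B0B.
have st' : stage B0 D Q (E `|` [set j]) B'.
  split=> //=.
  - by move=> i [/ED //|->].
  - exact: subset_trans BB'.
  - by move=> i [/EQ|-> //]; apply: Qmono.
have Ej : (E `|` [set j]) j by right.
have EEj : E `<=` E `|` [set j] by move=> i; left.
have nEjE : ~ E `|` [set j] `<=` E by move=> sub; apply/nEj/sub.
have /asboolP[e|[/nEjE //]] := tmax (exist _ (E `|` [set j], B') st')
  (asboolT (or_intror (And3 EEj nEjE BB'))).
by move/(congr1 (fun p => (sval p).1 j)): e => /= e; case: nEj; rewrite -e.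
Qed.

Hypothesis generic : forall B t a, good B -> regular a ->
  exists w, forall p, coef_in B p -> p != 0 -> regular p.[t + a * w].

Lemma good_generic B t a : good B -> regular a ->
  exists w, good (adjoin B (t + a * w)).
Proof.
move=> gB ra; have [w wP] := generic t gB ra; exists w.
apply: good_adjoin => // p Bp pw; apply: wP => //; apply: contraNneq pw => p0.
by rewrite p0 horner0.
Qed.

(** Write [x = c * a + y] with [y] a combination of [s].  If [s] has a nonzero
element [b], the solution can be shifted by a multiple of the relation between
[a] and [b], which replaces [c] by [c + b * w] with [w] generic.  After
adjoining this element, [x - (c + b * w) * a] is a problem with one generator
less.  If all of [s] vanishes, [c] is the quotient of [x] by [a]. *)
Lemma good_lin s B x : good B -> (forall y, y \in s -> B y) -> B x ->
  lin setT s x -> exists B', [/\ good B', B `<=` B' & lin B' s x].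
Proof.
elim: s B x => [|a s IHs] B x gB sB Bx /=; first by move=> ->; exists B; split.
have Ba : B a by apply: sB; rewrite mem_head.
have {}sB y : y \in s -> B y by move=> ys; apply: sB; rewrite inE ys orbT.
have BB := good_subring gB.
move=> [c [y [_ ly xe]]].
have [[b bs b0]|s0] := pselect (exists2 b, b \in s & b != 0).
  (* [(c + b * w) * a + (y - w * a * b)] is the same solution, shifted. *)
  have [w gB1] := good_generic c gB (good_regular gB (sB b bs) b0).
  have BB1 := adjoin_base (c + b * w) BB.
  have gen := adjoin_gen (c + b * w) BB.
  set B1 := adjoin _ _ in gB1 BB1 gen.
  have [_ B1S B1M] := good_subring gB1.
  have [|||B' [gB' B1B' lB']] := IHs B1 (x - (c + b * w) * a) gB1.
  - by move=> z /sB /BB1.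
  - by apply: B1S; [apply: BB1 | apply: B1M => //; apply: BB1].
  - have -> : x - (c + b * w) * a = y - w * a * b.
      by rewrite xe mulrDl opprD addrACA subrr add0r -mulrA mulrC.
    have lI := lin_is_ideal s.
    by apply: is_idealB => //; apply: is_idealM => //; apply: lin_mem.
  exists B'; split=> //; first exact: subset_trans B1B'.
  exists (c + b * w), (x - (c + b * w) * a); split=> //; first exact: B1B'.
  by rewrite addrC subrK.
have y0 : y = 0.
  apply: (lin_min (I := [set 0]) _ _ ly).
    by split=> [|u v /= -> ->|u v /= ->] /=; rewrite ?addr0 ?mulr0.
  by move=> z zs; apply/eqP; apply: contraT => z0; case: s0; exists z.
rewrite y0 addr0 in xe.
have [a0|a0] := eqVneq a 0.
  exists B; split=> //; exists 0, 0; rewrite xe a0 !mulr0 addr0.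
  by split=> //; [|apply: lin0]; apply: subring0.
exists (adjoin B c); split.
- by apply: (good_quotient KN KK gB Ba a0); rewrite mulrC -xe.
- exact: adjoin_base.
- exists c, 0; split; [exact: adjoin_gen | | by rewrite addr0].
  by apply: lin0; apply: subring0; apply: adjoin_subring.
Qed.

(** One round solves all the equations over the current ring, and the union of
countably many rounds is closed. *)
Lemma good_closure B0 : good B0 -> exists A, [/\ good A, B0 `<=` A &
  forall s x, (forall y, y \in s -> A y) -> A x -> lin setT s x -> lin A s x].
Proof.
move=> gB0.
have /choice[nxt nxtP] : forall B, exists B', good B -> [/\ good B', B `<=` B' &
    forall s x, (forall y, y \in s -> B y) -> B x -> lin setT s x -> lin B' s x].
  move=> B; have [gB|] := pselect (good B); last by exists B.
  pose D := [set p : seq T * T | [/\ forall y, y \in p.1 -> B y, B p.2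
                                   & lin setT p.1 p.2]].
  have [||||B' [gB' BB' DB']] := @good_tasks _ D (fun p C => lin C p.1 p.2) B.
  - apply: (@small_sub _ _ _ ([set s : seq T | forall y, y \in s -> B y] `*` B)).
      by move=> p [].
    by apply: small_pair => //; [apply: small_seq => //|]; case: gB.
  - by [].
  - by move=> p C C' CC'; apply: lin_subset.
  - move=> [s x] C [/= sB Bx ls] gC BC; apply: good_lin => //; last exact: BC.
    by move=> y /sB /BC.
  by exists B' => _; split=> // s x sB Bx ls; apply: (DB' (s, x)).
pose F n := iter n nxt B0.
have gF n : good (F n) by elim: n => // n /nxtP[].
have FS n : F n `<=` F n.+1 by case: (nxtP _ (gF n)).
have Fle m n : (m <= n)%N -> F m `<=` F n.
  move=> /subnK <-; elim: (n - m)%N => // k IHk.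
  by rewrite addSn; apply: subset_trans IHk (FS _).
have chain m n : F m `<=` F n \/ F n `<=` F m.
  by case/orP: (leq_total m n) => /Fle; [left | right].
exists (\bigcup_(n in [set: nat]) F n); split.
- by apply: good_bigcup => //; apply: small_countable.
- by move=> x B0x; exists 0%N.
move=> s x sA Ax ls.
have [|||_ [n _ <-] xsF] :=
    @chain_seq _ [set F n | n in [set: nat]] (x :: s).
- by move=> _ _ [m _ <-] [n _ <-]; apply: chain.
- by exists (F 0%N), 0%N.
- move=> y; rewrite inE => ys.
  have [n _ Fy] : (\bigcup_(n in [set: nat]) F n) y by case/orP: ys => [/eqP ->|/sA].
  by exists (F n) => //; exists n.
have [_ _ nxtn] := nxtP _ (gF n).
apply: (@lin_subset _ (F n.+1)); first by move=> y Fy; exists n.+1.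
apply: nxtn => //; last by apply: xsF; rewrite mem_head.
by move=> y ys; apply: xsF; rewrite inE ys orbT.
Qed.

End Closure.

(** * Subrings whose completion is the ambient ring *)

Section Subdomain.

(** The data that make a subset of [T] a domain in its own right. *)
Record subdomain (T : comNzRingType) := Subdomain {
  sd_set : set T;
  sd_subring : is_subring sd_set;
  sd_regular : forall x, sd_set x -> x != 0 -> regular x }.

Variables (T : comNzRingType) (D : subdomain T).

Record sd_type := SdType {
  sd_val : T;
  sd_valP : sd_val \in subring_pred (sd_subring D) }.

HB.instance Definition _ := [isSub for sd_val].
HB.instance Definition _ := [Choice of sd_type by <:].
HB.instance Definition _ := [SubChoice_isSubComNzRing of sd_type by <:].

Lemma sd_in (x : sd_type) : sd_set D (sd_val x).
Proof. by have /asboolP := sd_valP x. Qed.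

Lemma sd_lift t : sd_set D t -> exists x : sd_type, sd_val x = t.
Proof.
move=> Dt; have Pt : t \in subring_pred (sd_subring D) by apply/asboolP.
by exists (SdType Pt).
Qed.

Let unit : {pred sd_type} := fun x => `[< exists y, y * x = 1 >].
Let inv (x : sd_type) : sd_type :=
  if pselect (exists y, y * x = 1) is left h then projT1 (cid h) else x.

Let mulVx : {in unit, left_inverse 1 inv *%R}.
Proof.
move=> x /asboolP ux; rewrite /inv; case: pselect => // h.
by case: (cid h).
Qed.

Let unitPl : forall x y, y * x = 1 -> x \in unit.
Proof. by move=> x y yx; apply/asboolP; exists y. Qed.

Let invr_out : {in [predC unit], inv =1 id}.
Proof.
by move=> x /negP nux; rewrite /inv; case: pselect => // h; case: nux; apply/asboolP.
Qed.

HB.instance Definition _ :=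
  GRing.ComNzRing_hasMulInverse.Build sd_type mulVx unitPl invr_out.

Let integral : forall x y : sd_type, x * y = 0 -> (x == 0) || (y == 0).
Proof.
move=> x y /(congr1 sd_val) xy; have [//|x0] /= := eqVneq x 0.
apply/eqP/val_inj; apply: (sd_regular (sd_in x)) xy.
by apply: contraNneq x0 => e; apply/eqP/val_inj.
Qed.

HB.instance Definition _ := GRing.ComUnitRing_isIntegral.Build sd_type integral.

End Subdomain.

Section CompletionCriterion.
Variables (T : comNzRingType) (M : idealr T) (D : subdomain T).
Hypotheses (locT : local_ring M).
Hypothesis D_lin : forall s x, (forall y, y \in s -> sd_set D y) -> sd_set D x ->
  lin setT s x -> lin (sd_set D) s x.
Hypothesis D_dense : forall t, exists2 x, sd_set D x & t - x \in M.
Local Notation A := (sd_type D).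
Local Notation val := (@sd_val T D).

(** The ideal [M ∩ A]. *)
Definition contraction : {pred A} := [pred x | val x \in M].

Lemma in_contraction x : (x \in contraction) = (val x \in M).
Proof. by []. Qed.

Lemma contraction_closed : idealr_closed contraction.
Proof.
split; [exact: rpred0 | by rewrite in_contraction idealr1 |].
move=> a u v; rewrite !in_contraction => um vm.
exact: (rpredD (idealMr (val a) um) vm).
Qed.

HB.instance Definition _ := isIdealr.Build A contraction contraction_closed.

(** Membership in a finitely generated ideal may be tested in [T]; this is the
form in which the solvability hypothesis is used. *)
Lemma lin_sd (s : seq A) (x : A) : lin setT (map val s) (val x) -> lin setT s x.
Proof.
move=> ls; have {ls} : lin (sd_set D) (map val s) (val x).
  by apply: D_lin => //; [move=> _ /mapP[y _ ->]|]; apply: sd_in.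
elim: s x => [|a s IHs] x /=; first by move=> x0; apply: val_inj.
move=> [c [y [Dc ly xe]]]; have [c' ce] := sd_lift Dc.
exists c', (x - c' * a); split=> //; last by rewrite addrC subrK.
by apply: IHs; rewrite /= ce xe addrC addKr.
Qed.

Lemma lift_seq (S : set A) (t : seq T) : (forall y, y \in t -> (val @` S) y) ->
  exists2 s : seq A, map val s = t & forall x, x \in s -> S x.
Proof.
elim: t => [|a t IHt] tS; first by exists [::].
have [|s st sS] := IHt; first by move=> y yt; apply: tS; rewrite inE yt orbT.
have [x Sx xa] := tS a (mem_head _ _).
exists (x :: s); first by rewrite /= st xa.
by move=> y; rewrite inE => /orP[/eqP ->|/sS].
Qed.

Lemma span_contraction (J : set A) x : is_ideal J -> span (val @` J) (val x) -> J x.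
Proof.
move=> JJ [t tJ lt]; have [s st sJ] := lift_seq tJ.
by apply: (lin_min JJ sJ); apply: lin_sd; rewrite st.
Qed.

(** The extension of an ideal to [T] is generated by finitely many elements of
the ideal itself, and these generate the ideal by [lin_sd]. *)
Lemma sd_noetherian : noetherian A.
Proof.
move=> J JJ; have [noethT _ _] := locT.
have [t tJ Jt] := noetherian_span (val @` [set x | x \in J]) noethT.
have [s st sJ] := lift_seq tJ.
exists s => x; rewrite -lin_sumP; split=> [Jx|].
  by apply: lin_sd; rewrite st; apply/Jt/span_sub; exists x.
by move=> lx; apply: (lin_min (ideal_is_ideal JJ) sJ lx).
Qed.

(** The equation [y * x = 1] has a solution in [T], hence in [A]. *)
Lemma sd_unit x : x \notin contraction -> exists y, y * x = 1.
Proof.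
rewrite in_contraction => /(local_unit locT)[y xy].
have [c [_ [_ -> e]]] : lin setT [:: x] 1.
  apply: lin_sd; rewrite /= -xy; exists y, 0; split=> //.
  by rewrite addr0 mulrC.
by exists c; rewrite [RHS]e addr0.
Qed.

Lemma sd_local : local_ring contraction.
Proof.
have nonunit (N : idealr A) x : x \in N -> x \in contraction.
  move=> xN; apply: contraT => /sd_unit[y yx].
  by have := idealr1 N; rewrite -yx idealMr.
split; first exact: sd_noetherian.
  by move=> J mJ x; apply/idP/idP => [/nonunit|/mJ].
by move=> N Nmax x; rewrite (Nmax contraction) // => y /nonunit.
Qed.

Hypothesis D_gens : exists g : seq T, [/\ forall y, y \in g -> y \in M,
  forall y, y \in M -> lin setT g y
  & forall y, y \in g -> exists2 x, sd_set D x & x - y \in ideal_pow M 2].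

(** Generators are eliminated one at a time.  The class of [a] modulo [N] lies in
[M^2], hence in [M a + (s)] modulo [N]; this gives [(1 - mu) a] in [N + (s)] with
[mu] in [M], and [1 - mu] is a unit. *)
Lemma nakayama (N : set T) (s : seq T) : is_ideal N ->
  (forall y, y \in M -> exists2 u, N u & lin setT s (y - u)) ->
  (forall y, y \in s -> exists2 u, N u & y - u \in ideal_pow M 2) ->
  forall y, y \in M -> N y.
Proof.
move=> NN; elim: s => [|a s IHs] MNs sN.
  by move=> y /MNs[u Nu /= /eqP]; rewrite subr_eq0 => /eqP ->.
have linN := lin_is_ideal s.
apply: IHs; last by move=> y ys; apply: sN; rewrite inE ys orbT.
(* [W] is the ideal [M a + N + (s)]. *)
pose W := [set w | exists mu u, [/\ mu \in M, N u & lin setT s (w - mu * a - u)]].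
have WW : is_ideal W.
  split.
  - exists 0, 0; split; [exact: rpred0 | exact: is_ideal0 |].
    by rewrite mul0r !subr0; apply: is_ideal0.
  - move=> w w' [mu [u [muM Nu lu]]] [nu [v [nuM Nv lv]]].
    exists (mu + nu), (u + v); split; [exact: rpredD | exact: is_idealD |].
    have -> : w + w' - (mu + nu) * a - (u + v) = (w - mu * a - u) + (w' - nu * a - v).
      by rewrite mulrDl !opprD [w + w' + _]addrACA [LHS]addrACA.
    exact: (is_idealD linN lu lv).
  - move=> b w [mu [u [muM Nu lu]]]; exists (b * mu), (b * u).
    split; [exact: idealMr | exact: is_idealM |].
    by rewrite -mulrA -!mulrBr; apply: is_idealM.
have M2W w : w \in ideal_pow M 2 -> W w.
  apply: (ideal_pow_min WW) => -[|x [|y [|? ?]]] // _ sM.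
  have xM : x \in M by apply: sM; rewrite !inE eqxx.
  have yM : y \in M by apply: sM; rewrite !inE eqxx orbT.
  rewrite big_cons big_seq1.
  have [u Nu [c [l [_ ll e]]]] := MNs x xM.
  exists (y * c), (y * u); split.
  - by rewrite mulrC idealMr.
  - exact: is_idealM.
  - have -> : x * y - y * c * a - y * u = y * l.
      move/eqP: e; rewrite subr_eq => /eqP ->.
      by rewrite [_ * y]mulrC !mulrDr mulrA addrAC addrK addrC addKr.
    exact: is_idealM.
have [u Nu /M2W[mu [v [muM Nv lv]]]] := sN a (mem_head _ _).
have [|e ue] := @local_unit _ _ locT (1 - mu).
  by apply/negP => /(rpredD muM); rewrite addrC subrK idealr1.
have [v' Nv' la] : exists2 v', N v' & lin setT s (a - v').
  exists (e * (u + v)); first by apply: is_idealM => //; apply: is_idealD.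
  have -> : a - e * (u + v) = e * (a - u - mu * a - v).
    rewrite -{1}[a]mul1r -ue [(1 - mu) * e]mulrC -mulrA -mulrBr; congr (e * _).
    rewrite mulrBl mul1r opprD !addrA; congr (_ - _).
    by rewrite addrAC.
  exact: is_idealM.
move=> y /MNs[w Nw [c [l [_ ll e1]]]].
exists (w + c * v'); first by apply: is_idealD => //; apply: is_idealM.
have -> : y - (w + c * v') = c * (a - v') + l.
  by rewrite opprD addrA e1 mulrBr addrAC.
by apply: is_idealD => //; apply: is_idealM.
Qed.

Definition pow_image n : set T := val @` [set x | x \in ideal_pow contraction n].

Lemma maximal_extended y : y \in M -> span (pow_image 1) y.
Proof.
have [g [gM Mg gD]] := D_gens.
apply: (@nakayama _ g); first exact: span_is_ideal.
  move=> z zM; exists 0; first exact: is_ideal0 (span_is_ideal _).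
  by rewrite subr0; apply: Mg.
move=> z zg; have [x Dx xz] := gD z zg; exists x; last first.
  by rewrite -rpredN opprB.
have [x' x'x] := sd_lift Dx; apply: span_sub; exists x' => //=.
rewrite ideal_pow1 in_contraction x'x -[x](subrK z) rpredD //; last exact: gM.
exact: ideal_pow_sub xz.
Qed.

(** The powers of [M] are generated by those of [M ∩ A], since [M] is. *)
Lemma pow_image_span n y : y \in ideal_pow M n -> span (pow_image n) y.
Proof.
move: y; apply: ideal_pow_min => [|s <-]; first exact: span_is_ideal.
have ideal_colon p k : is_ideal [set x | span (pow_image k) (x * p)].
  have [s0 sD sM] := span_is_ideal (pow_image k).
  split=> [|x y /= sx sy|a x /= sx] /=; first by rewrite mul0r.
    by rewrite mulrDl; apply: sD.
  by rewrite -mulrA; apply: sM.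
elim: s => [|x s IHs] sM.
  rewrite big_nil; apply: span_sub; exists 1 => //; exact: ideal_pow0.
rewrite big_cons /=; have xM : x \in M by apply: sM; rewrite mem_head.
apply: (span_min (ideal_colon _ _) _ (maximal_extended xM)) => _ [mu muM <-] /=.
rewrite mulrC; apply: (span_min (ideal_colon _ _) _ (IHs _)).
  move=> _ [e en <-] /=; rewrite mulrC; apply: span_sub; exists (mu * e) => //=.
  by rewrite -[(size s).+1]add1n; apply: ideal_powM.
by move=> y ys; apply: sM; rewrite inE ys orbT.
Qed.

Lemma pow_val n x : x \in ideal_pow contraction n -> val x \in ideal_pow M n.
Proof.
have [p0 pD pM] := ideal_pow_is_ideal M n.
move: x; apply: ideal_pow_min => [|s sn sm].
  by split=> [|x y /= px py|a x /= px] /=; [exact: p0 | exact: pD | exact: pM].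
have -> : val (\prod_(x <- s) x) = \prod_(x <- map val s) x.
  by elim: s {sn sm} => [|a s IHs]; rewrite ?big_nil //= !big_cons /= -IHs.
apply: ideal_pow_prod; first by rewrite size_map.
by move=> _ /mapP[x /sm xm ->].
Qed.

(** The topology of [A] is induced by that of [T]. *)
Lemma pow_contraction n x : val x \in ideal_pow M n -> x \in ideal_pow contraction n.
Proof. by move=> /pow_image_span /(span_contraction (ideal_pow_is_ideal _ _)). Qed.

(** An element of [M^n] is a combination of elements of [(M ∩ A)^n]; replacing the
coefficients by elements of [A] congruent modulo [M] changes it by an element
of [M^(n+1)]. *)
Lemma sd_dense n t : exists x : A, t - val x \in ideal_pow M n.
Proof.
elim: n => [|n [x xn]]; first by exists 0; apply: ideal_pow0.
suff [y yn] : exists y : A, (t - val x) - val y \in ideal_pow M n.+1.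
  by exists (x + y); rewrite /= opprD addrA.
have [s] := pow_image_span xn; elim: s (t - val x) => [|a s IHs] u sn.
  by move=> ->; exists 0; rewrite subr0 rpred0.
move=> [c [l [_ ll ->]]].
have [|y yl] := IHs l _ ll; first by move=> z zs; apply: sn; rewrite inE zs orbT.
have [e en ea] := sn a (mem_head _ _).
have [d Dd cd] := D_dense c; have [d' d'd] := sd_lift Dd.
exists (d' * e + y).
have -> : c * a + l - val (d' * e + y) = (c - d) * val e + (l - val y).
  by rewrite /= d'd ea mulrBl opprD addrACA.
by rewrite rpredD // ideal_powS // pow_val.
Qed.

Hypothesis complT : adic_complete M.

(** [t] is the limit of [F].  Arbitrary representatives of the components are
allowed, which makes compatibility with the ring operations immediate. *)
Definition limit_of (F : adic_completion contraction) (t : T) : Prop :=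
  forall n, exists2 x : A, adic_pi contraction n x = adic_val F n
    & t - val x \in ideal_pow M n.+1.

Lemma limit_exists F : exists t, limit_of F t.
Proof.
have [|t tP] := adic_limit complT (s := fun n => val (repr (adic_val F n))).
  move=> n; apply: (@pow_val _ (repr (adic_val F n.+1) - repr (adic_val F n))).
  by apply/adic_pi_eqP; rewrite adic_piK (adic_coherentE F (leqnSn n)).
by exists t => n; exists (repr (adic_val F n)); [apply: adic_piK | apply: tP].
Qed.

Lemma limit_unique F t u : limit_of F t -> limit_of F u -> t = u.
Proof.
move=> tF uF; apply/eqP; rewrite -subr_eq0; apply/eqP/(adic_separated complT) => n.
apply: ideal_pow_decr; have [x xF tx] := tF n; have [y yF uy] := uF n.
have -> : t - u = (t - val x) - (u - val y) + val (x - y).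
  by rewrite opprB /= [RHS]addrAC !addrA !subrK.
apply: rpredD; first exact: rpredB.
by apply: pow_val; apply/adic_pi_eqP; rewrite xF yF.
Qed.

Lemma sd_completion : is_completion_of T contraction.
Proof.
have /choice[f fP] := limit_exists.
have f_eq F t : limit_of F t -> f F = t by apply: limit_unique.
have fB : zmod_morphism f.
  move=> F G; apply: f_eq => n; have [x xF tx] := fP F n; have [y yG uy] := fP G n.
  exists (x - y).
    rewrite -[RHS]/(adic_val F n - adic_val G n) -xF -yG.
    exact: (rmorphB (adic_pi contraction n)).
  have -> : f F - f G - val (x - y) = (f F - val x) - (f G - val y).
    by rewrite /= !opprB addrACA [RHS]addrACA [- f G + _]addrC.
  by rewrite rpredB.
have fM : monoid_morphism f.
  split; first by apply: f_eq => n; exists 1; rewrite ?rmorph1 //= subrr rpred0.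
  move=> F G; apply: f_eq => n; have [x xF tx] := fP F n; have [y yG uy] := fP G n.
  exists (x * y).
    rewrite -[RHS]/(adic_val F n * adic_val G n) -xF -yG.
    exact: (rmorphM (adic_pi contraction n)).
  have -> : f F * f G - val (x * y) = f F * (f G - val y) + val y * (f F - val x).
    by rewrite !mulrBr addrA /= [val y * f F]mulrC subrK [val y * _]mulrC.
  by rewrite rpredD ?idealMr.
pose h : {rmorphism adic_completion contraction -> T} := HB.pack f
  (GRing.isZmodMorphism.Build _ _ f fB) (GRing.isMonoidMorphism.Build _ _ f fM).
exists h.
have h_inj : injective f.
  move=> F G e; apply: completionP => n.
  have [x <- tx] := fP F n; have [y <- uy] := fP G n.
  apply/adic_pi_eqP/pow_contraction.
  have -> : val (x - y) = (f G - val y) - (f F - val x).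
    by rewrite e opprB [RHS]addrC addrA subrK.
  by rewrite rpredB.
have /choice[g gP] : forall t, exists F, f F = t.
  move=> t; have /choice[s sP] : forall n, exists x : A, t - val x \in ideal_pow M n.+1.
    by move=> n; apply: sd_dense.
  pose F : prod_ring (adic_quot contraction) := fun n => adic_pi contraction n (s n).
  have cF : F \in adic_coherent (I := contraction).
    apply/adic_coherentP => n; rewrite /F adic_transE; apply/adic_pi_eqP.
    apply: pow_contraction.
    have -> : val (s n.+1 - s n) = (t - val (s n)) - (t - val (s n.+1)).
      by rewrite opprB [RHS]addrC addrA subrK.
    by rewrite rpredB // ideal_pow_decr.
  by exists (AdicCompletion cF); apply: f_eq => n; exists (s n).
exists g; last exact: gP.
by move=> F; apply: h_inj; rewrite gP.
Qed.

End CompletionCriterion.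

(** * Construction of the small domain *)

Section Sufficiency.
Variables (T : comNzRingType) (M : idealr T).
Hypotheses (locT : local_ring M) (complT : adic_complete M).
Hypothesis int_regular : forall z : int, (z%:~R : T) != 0 -> ~ zerodivisor (z%:~R : T).
Hypothesis M_notin_Ass : ~ Ass T M.
Hypothesis card_residue : card_lt {ideal_quot M} T.

(** The factor [z * z] places the power series in [M^2]. *)
Lemma generic_points : exists phi : (nat -> {ideal_quot M}) -> T,
  (forall c, phi c \in ideal_pow M 2) /\
  forall c d, c <> d -> regular (phi c - phi d).
Proof.
have [noethT Mmax _] := locT.
have [z zM zreg] := regular_in_maximal noethT Mmax M_notin_Ass.
have [psi psi_reg] := regular_differences locT complT zM zreg.
exists (fun c => z * (z * psi c)); split=> [c|c d cd].
  by rewrite ideal_powS // ideal_pow1 mulrC idealMr.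
by rewrite -!mulrBr; do 2 apply: regularM => //; apply: psi_reg.
Qed.

(** The construction starts from the image of the integers; this is where the
condition on integers enters. *)
Lemma prime_subring_good (K : Type) : embeds nat K ->
  good K [set x : T | exists z : int, x = z%:~R].
Proof.
move=> KN; split; first split.
- by exists 1.
- by move=> _ _ [y ->] [z ->]; exists (y - z); rewrite rmorphB.
- by move=> _ _ [y ->] [z ->]; exists (y * z); rewrite rmorphM.
- move=> _ [z ->] z0 y zy; apply/eqP; apply: contraT => y0.
  by case: (int_regular z0); exists y.
- apply: (@small_sub _ _ _ ((fun z : int => z%:~R) @` [set: int])).
    by move=> _ [z ->]; exists z.
  by apply: small_image => //; apply: small_countable.
Qed.

(** Two kinds of elements are first brought into a good subring modulo [M^2]:
representatives of the residue classes, for density, and generators of [M], for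
the Nakayama argument.  Then the ring is closed under linear equations. *)
Lemma sufficiency : exists (A : idomainType) (m : idealr A),
  [/\ local_ring m, is_completion_of T m & card_lt A T].
Proof.
have [noethT _ _] := locT; pose k := {ideal_quot M}; pose K := (k + nat)%type.
have KN : embeds nat K by exists inr => m n [].
have KK := embeds_square KN.
have nK : ~ embeds (nat -> k) K.
  apply: sequences_not_embedded card_residue _ (embeds_residue_sequences locT complT).
  exists (fun b : bool => if b then 1 else 0) => -[] [] // /eqP;
    by rewrite ?oner_eq0 // eq_sym oner_eq0.
have [phi [phiM phi_reg]] := generic_points.
have genericM (B : set T) (t a : T) : good K B -> regular a -> exists2 w, w \in ideal_pow M 2 &
    forall p, coef_in B p -> p != 0 -> regular p.[t + a * w].
  move=> gB ra; have [c cP] := generic_exists KN KK noethT t nK phi_reg gB ra.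
  by exists (phi c).
have generic (B : set T) (t a : T) : good K B -> regular a ->
    exists w, forall p, coef_in B p -> p != 0 -> regular p.[t + a * w].
  by move=> gB ra; have [w _ wP] := genericM B t a gB ra; exists w.
have [g gM Mg] := noetherian_span [set x | x \in M] noethT.
pose D := [set (repr q : T) | q in [set: k]] `|` [set x | x \in g].
have [|||B [gB _ BD]] := @good_tasks T K KN KK T D
    (fun t (B : set T) => exists2 x, B x & x - t \in ideal_pow M 2) _ _ (prime_subring_good KN).
- rewrite /D -bigcup2E; apply: small_bigcup => // [|[|[|i]] _] /=.
  + by apply: small_countable.
  + apply: small_image => //; apply/small_embeds; exists inl => x y [] //.
  + case: KN => e ei; exists (fun x => e (index x g)) => x y xg yg /ei.
    by move/(congr1 (nth 0 g)); rewrite !nth_index.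
  + by case: KN => e _; exists (fun=> e 0%N).
- by move=> t B B' BB' [x Bx xt]; exists x => //; apply: BB'.
- move=> t B _ gB _; have [w wM wP] := genericM B t 1 gB (@regular1 T).
  exists (adjoin B (t + 1 * w)); split.
  + apply: good_adjoin => // p Bp pw; apply: wP => //.
    by apply: contraNneq pw => ->; rewrite horner0.
  + by apply: adjoin_base; apply: good_subring gB.
  + exists (t + 1 * w); first by apply: adjoin_gen; apply: good_subring gB.
    by rewrite mul1r addrC addKr.
have [A [gA BA A_lin]] := good_closure KN KK generic gB.
pose S := Subdomain (good_subring gA) (good_regular gA).
have dense t : exists2 x, sd_set S x & t - x \in M.
  pose q : k := \pi_k t.
  have [|x Bx xq] := BD (repr q); first by left; exists q.
  exists x; first exact: BA.
  have -> : t - x = (t - repr q) - (x - repr q) by rewrite opprB addrA subrK.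
  by rewrite rpredB //; [rewrite Quotient.idealrBE reprK | apply: ideal_pow_sub xq].
have gens : exists g : seq T, [/\ forall y, y \in g -> y \in M,
    forall y, y \in M -> lin setT g y
    & forall y, y \in g -> exists2 x, sd_set S x & x - y \in ideal_pow M 2].
  exists g; split=> // [y yM|y yg]; first exact/Mg/span_sub.
  by have [|x Bx xy] := BD y; [right | exists x => //; apply: BA].
exists (sd_type S), (@contraction T M S); split.
- exact: sd_local.
- exact: sd_completion.
- apply: card_lt_intro; first by exists (@sd_val _ _); apply: val_inj.
  move=> TS; apply: nK; apply: (@embeds_trans _ T).
    exists phi => c d e; have [//|/phi_reg] := pselect (c = d).
    by rewrite e subrr => /(_ 1); rewrite mul0r => /(_ erefl) /eqP; rewrite oner_eq0.
  apply: embeds_trans TS _; have [f fi] := good_small gA.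
  exists (fun x : sd_type S => f (sd_val x)) => x y /(fi _ _ (sd_in x) (sd_in y)).
  exact: val_inj.
Qed.

End Sufficiency.

Theorem corollary2p14 (T : comNzRingType) (M : idealr T)
    (T_local : local_ring M) (T_complete : adic_complete M) :
  (exists (A : idomainType) (m : idealr A),
     [/\ local_ring m, is_completion_of T m & card_lt A T])
  <->
  [/\ forall z : int, (z%:~R : T) != 0 -> ~ zerodivisor (z%:~R : T),
      ~ Ass T M
    & card_lt {ideal_quot M} T].
Proof.
split=> [[A [m [locA [f f_bij] cardA]]]|[int_reg nAss cardk]].
  exact: (necessity T_local locA f_bij cardA).
exact: (sufficiency T_local T_complete int_reg nAss cardk).
Qed.
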